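(* Let $\chi$ be a real, primitive, nonprincipal Dirichlet character with Dirichlet $L$-function $L(s,\chi)$. Let $v\in\mathbb{C}$ and $w\in\mathbb{C}$ with $\Re(w)>0$. If $\chi$ is even, then as $t\rightarrow0^{+}$, $$\sum_{n\ge1}\chi(n)e^{-w n^2t^2-v nt}\sim e^{v^2/(8w)}\sum_{n\ge0}\frac{(2w)^{(2n+1)/2}(-t)^{2n+1}}{(2n+1)!}L(-2n-1,\chi)D_{2n+1}\Big(\frac{v}{\sqrt{2w}}\Big),$$ and if $\chi$ is odd, then as $t\rightarrow0^{+}$, $$\sum_{n\ge1}\chi(n)e^{-w n^2t^2-v nt}\sim e^{v^2/(8w)}\sum_{n\ge0}\frac{(2w)^{n}(-t)^{2n}}{(2n)!}L(-2n,\chi)D_{2n}\Big(\frac{v}{\sqrt{2w}}\Big).$$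
   Context: $L(s,\chi)=\sum_{n\ge1}\chi(n)n^{-s}$, analytically continued to $\mathbb{C}$. $\chi$ is even if $\chi(-1)=1$ and odd if $\chi(-1)=-1$. $D_s(x)$ is the parabolic cylinder (Weber) function; for nonnegative integers $n$, $D_n(x)=2^{-n/2}e^{-x^2/4}H_n(x/\sqrt2)$ with $H_n$ the Hermite polynomial. The symbol $f(t)\sim\sum_{n\ge0}a_nt^{n}$ as $t\to0^+$ denotes an asymptotic expansion: for every $N$, $f(t)-\sum_{n=0}^{N}a_nt^n=O(t^{N+1})$ as $t\to0^+$. Principal branch of the square root is used. *)

(* Defs.v *)
From Stdlib Require Import Reals ZArith Lra.
From Coquelicot Require Import Coquelicot.

Open Scope C_scope.

Definition Cexp (z : C) : C :=
  (exp (Re z) * cos (Im z), exp (Re z) * sin (Im z))%R.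

(* Principal branch: nonnegative real part, and the negative real axis is sent
   to the positive imaginary axis. *)
Definition Csqrt (z : C) : C :=
  (sqrt ((Cmod z + Re z) / 2),
   if Rlt_dec (Im z) 0 then - sqrt ((Cmod z - Re z) / 2)
   else sqrt ((Cmod z - Re z) / 2))%R.

(* [x ^ s] for a real base [x > 0]. *)
Definition RCpow (x : R) (s : C) : C := Cexp (s * RtoC (ln x)).

(* As with Coquelicot's [Series], only meaningful for convergent series. *)
Definition CSeries (a : nat -> C) : C :=
  (Series (fun n => Re (a n)), Series (fun n => Im (a n))).

(* Locally the sum of a convergent power series around every point of [C]. *)
Definition analytic_on_C (F : C -> C) : Prop :=
  forall s0 : C, exists (a : nat -> C) (r : posreal),
    forall s : C, (Cmod (s - s0) < r)%R ->
      is_pseries (K := C_AbsRing) (V := C_NormedModule) a (s - s0) (F s).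

(* Characters modulo [q] are extended by zero to all of [Z]. *)
Definition dirichlet_character (q : Z) (chi : Z -> C) : Prop :=
  (0 < q)%Z /\
  (forall n : Z, chi (n + q)%Z = chi n) /\
  (forall m n : Z, chi (m * n)%Z = chi m * chi n) /\
  (forall n : Z, chi n <> 0 <-> Z.gcd n q = 1%Z).

Definition real_character (chi : Z -> C) : Prop :=
  forall n : Z, Im (chi n) = 0%R.

Definition principal_character (q : Z) (chi : Z -> C) : Prop :=
  forall n : Z, Z.gcd n q = 1%Z -> chi n = 1.

Definition induced_from (q : Z) (chi : Z -> C) (d : Z) : Prop :=
  exists chi' : Z -> C, dirichlet_character d chi' /\
    forall n : Z, Z.gcd n q = 1%Z -> chi n = chi' n.

Definition primitive_character (q : Z) (chi : Z -> C) : Prop :=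
  forall d : Z, (0 < d < q)%Z -> (d | q)%Z -> ~ induced_from q chi d.

Definition even_character (chi : Z -> C) : Prop := chi (-1)%Z = 1.

Definition odd_character (chi : Z -> C) : Prop := chi (-1)%Z = -(1).

(* [L] is the analytic continuation to the whole plane of the Dirichlet series
   of [chi]; the series is summed from index 0, hence the shift. *)
Definition L_function (chi : Z -> C) (L : C -> C) : Prop :=
  analytic_on_C L /\
  forall s : C, (1 < Re s)%R ->
    is_series (K := C_AbsRing) (V := C_NormedModule)
      (fun k : nat => chi (Z.of_nat (S k)) * RCpow (INR (S k)) (- s)) (L s).

(* Physicists' normalisation. *)
Fixpoint hermite (n : nat) (x : C) : C :=
  match n with
  | O => 1
  | S p =>
      match p with
      | O => 2 * x
      | S m => 2 * x * hermite p x - 2 * RtoC (INR p) * hermite m x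
      end
  end.

Definition parabolic_cylinder_D (n : nat) (x : C) : C :=
  RtoC (Rpower 2 (- INR n / 2)) * Cexp (- (x ^ 2 / 4)) *
  hermite n (x / RtoC (sqrt 2)).

Definition asymptotic_expansion (f : R -> C) (a : nat -> C) : Prop :=
  forall N : nat, exists K : R,
    at_right 0 (fun t : R =>
      (Cmod (f t - sum_n (G := C_AbelianMonoid)
                      (fun n => (a n * RtoC (t ^ n))%C) N) <= K * t ^ (S N))%R).

(* Coefficient sequences of [sum_n b_n t^(2n+1)] and [sum_n b_n t^(2n)]. *)
Definition odd_powers (b : nat -> C) (m : nat) : C :=
  if Nat.odd m then b (Nat.div2 m) else 0.

Definition even_powers (b : nat -> C) (m : nat) : C :=
  if Nat.even m then b (Nat.div2 m) else 0.

Definition twisted_theta (chi : Z -> C) (v w : C) (t : R) : C :=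
  CSeries (fun k : nat =>
    let n := INR (S k) in
    chi (Z.of_nat (S k)) *
      Cexp (- (w * RtoC (n ^ 2) * RtoC (t ^ 2)) - v * RtoC n * RtoC t)).

Lemma CSeries_unique (a : nat -> C) (l : C) :
  is_series (K := C_AbsRing) (V := C_NormedModule) a l -> CSeries a = l.
Proof.
assert (Hsum : forall n, sum_n a n =
  (sum_n (fun k => Re (a k)) n, sum_n (fun k => Im (a k)) n)).
{ induction n as [|n IH].
  - rewrite !sum_O; now destruct (a 0%nat).
  - rewrite !sum_Sn, IH; now destruct (a (S n)). }
intros H; rewrite (surjective_pairing l); unfold CSeries; f_equal;
  apply is_series_unique; unfold is_series.
- apply filterlim_ext with (fun n => fst (sum_n a n)).
  { now intros n; rewrite Hsum. }
  apply filterlim_comp with (1 := H).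
  intros P [e He]; exists e; intros y Hy; apply He.
  apply Hy.
- apply filterlim_ext with (fun n => snd (sum_n a n)).
  { now intros n; rewrite Hsum. }
  apply filterlim_comp with (1 := H).
  intros P [e He]; exists e; intros y Hy; apply He.
  apply Hy.
Qed.

Lemma Csqrt_sqr (z : C) : Csqrt z * Csqrt z = z.
Proof.
assert (HRe : (- Cmod z <= Re z <= Cmod z)%R).
{ generalize (re_le_Cmod z); unfold Rabs; destruct (Rcase_abs (Re z)); lra. }
assert (H2 := Cmod2_alt z).
set (m := Cmod z) in *.
assert (Hp : (0 <= (m + Re z) / 2)%R) by lra.
assert (Hm : (0 <= (m - Re z) / 2)%R) by lra.
assert (Hprod : (sqrt ((m + Re z) / 2) * sqrt ((m - Re z) / 2)
                 = Rabs (Im z) / 2)%R).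
{ rewrite <- sqrt_mult by assumption.
  replace ((m + Re z) / 2 * ((m - Re z) / 2))%R with (Rsqr (Im z / 2))
    by (unfold Rsqr; nra).
  rewrite sqrt_Rsqr_abs; unfold Rdiv; rewrite Rabs_mult.
  now rewrite (Rabs_right (/ 2)) by lra. }
assert (Hs := sqrt_sqrt _ Hp); assert (Hd := sqrt_sqrt _ Hm).
unfold Csqrt; fold m.
set (a := sqrt ((m + Re z) / 2)) in *; set (b := sqrt ((m - Re z) / 2)) in *.
clearbody a b; destruct z as [x y]; simpl in *; unfold Cmult; simpl.
unfold Rabs in Hprod.
destruct (Rlt_dec y 0); destruct (Rcase_abs y); try lra; f_equal; lra.
Qed.

Lemma hermite_2_3 (x : C) :
  hermite 2 x = 4 * x ^ 2 - 2 /\ hermite 3 x = 8 * x ^ 3 - 12 * x.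
Proof.
split; simpl.
- ring.
- rewrite RtoC_plus; ring.
Qed.

(* Main.v *)
Require Import Defs.
From Stdlib Require Import Reals ZArith Lra Lia List Permutation FinFun Classical
  FunctionalExtensionality.
From Coquelicot Require Import Coquelicot.

(* A real nonprincipal character is a mean zero periodic sequence, so it is the
   difference of another such sequence. Iterated summation by parts then writes
   [sum_(n >= 1) chi n * g n] as boundary terms, linear in the values of [g] at
   [1, 2, ...], plus a series that only involves the [m]-th differences of [g].
   With [g x = x ^ (- s)] that series is real analytic in [s > 2 - m], so the identity
   theorem on the real line gives [L (- k)] as the boundary terms of [x ^ k], whose
   high differences vanish. With [g x = exp (- w (t x) ^ 2 - v t x)] the series is
   [O(t ^ (m - 1))], and a Taylor expansion of the boundary terms produces the values
   [L (- k)] against the Taylor coefficients of the Gaussian, which are Hermite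
   polynomials. Summing by parts over all of [Z] shows that [L (- k)] vanishes when
   [chi] and [k] are both even or both odd. *)

(** For [s <= 0] the terms of the Dirichlet series do not tend to 0, and in the Gaussian series a
    termwise Taylor expansion in [t] gives the same divergent sums of [chi n * n ^ k]. Differencing
    cures both: [x ^ (- s)] gains [m] powers of decay, while the Gaussian, a function of [t * x],
    gains a factor [t ^ m], of which one power is lost because about [1 / t] terms contribute. What
    is left outside the series is finitely many samples of [g], where expanding in [t] is
    legitimate.

    The single choice [m = N + 3] serves both sides: the tail is [O(t ^ (N + 2))], and the half-line
    [s > 2 - m] contains [- k] for every [k <= N]. The 2 in [2 - m] comes from comparison with the
    series of inverse squares. Only values of [L] at real points are wanted, and a complex power
    series around a real point restricts to two real ones, so everything is done on real and
    imaginary parts. *)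

Open Scope R_scope.

(* [sum_n] makes equalities at the carrier of a Coquelicot structure, which [ring]
   does not recognise as [R]. *)
Ltac real_ring :=
  cbv beta; match goal with |- ?x = ?y => change (@eq R x y); ring end.

(** * Finite sums of reals *)

Lemma sum_n_S (f : nat -> R) (p : nat) : sum_n f (S p) = sum_n f p + f (S p) :> R.
Proof. exact (sum_Sn f p). Qed.

Lemma sum_n_head (f : nat -> R) (p : nat) :
  sum_n f (S p) = f O + sum_n (fun i => f (S i)) p :> R.
Proof.
induction p as [|p IH].
- now rewrite sum_n_S, !sum_O.
- rewrite sum_n_S, IH, (sum_n_S _ p); ring.
Qed.

Lemma sum_n_rev (f : nat -> R) (p : nat) :
  sum_n (fun i => f (p - i)%nat) p = sum_n f p :> R.
Proof.
revert f; induction p as [|p IH]; intros f.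
- now rewrite !sum_O.
- rewrite sum_n_head, sum_n_S, <- (IH f); simpl; ring.
Qed.

Lemma Rabs_sum_n_le (f : nat -> R) (p : nat) :
  Rabs (sum_n f p) <= sum_n (fun i => Rabs (f i)) p.
Proof.
induction p as [|p IH]; [rewrite !sum_O; lra|].
rewrite !sum_Sn; unfold plus; simpl.
eapply Rle_trans; [apply Rabs_triang|lra].
Qed.

Lemma sum_n_scal_r (f : nat -> R) (c : R) (p : nat) :
  sum_n (fun i => f i * c) p = sum_n f p * c :> R.
Proof.
induction p as [|p IH]; [now rewrite !sum_O|].
rewrite !sum_n_S, IH; ring.
Qed.

Lemma ex_series_mult_l (c : R) (f : nat -> R) :
  ex_series f -> ex_series (fun n => c * f n).
Proof. exact (ex_series_scal_l (V := R_NormedModule) c f). Qed.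

(** * Mean zero periodic sequences and their antidifferences *)

(** The period is [S p]. Asking this of every window encodes periodicity too, since neighbouring
    windows differ only by their end terms. *)
Definition zero_mean (p : nat) (a : Z -> R) : Prop :=
  forall n : Z, sum_n (fun i => a (n - Z.of_nat i)%Z) p = 0 :> R.

Definition bounded_seq (a : Z -> R) : Prop := exists M, forall n, Rabs (a n) <= M.

(** The antidifference normalised to have mean zero again, which is what allows iteration. Averaging
    [c n - c (n - i) = a n + ... + a (n - i + 1)] over [i] and using the zero mean of [a] gives this
    formula. *)
Definition anti (p : nat) (a : Z -> R) (n : Z) : R :=
  - / INR (S p) * sum_n (fun i => INR i * a (n - Z.of_nat i)%Z) p.

Lemma zero_mean_periodic (p : nat) (a : Z -> R) (n : Z) :
  zero_mean p a -> a (n - 1 - Z.of_nat p)%Z = a n.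
Proof.
intros H.
assert (E : sum_n (fun i => a (n - Z.of_nat i)%Z) p
  - sum_n (fun i => a (n - 1 - Z.of_nat i)%Z) p = a n - a (n - 1 - Z.of_nat p)%Z).
{ clear H; induction p as [|p IH].
  - rewrite !sum_O; simpl; now rewrite !Z.sub_0_r.
  - rewrite !sum_n_S.
    replace (n - Z.of_nat (S p))%Z with (n - 1 - Z.of_nat p)%Z by lia; lra. }
rewrite !H in E; lra.
Qed.

Lemma anti_diff (p : nat) (a : Z -> R) (n : Z) :
  zero_mean p a -> anti p a n - anti p a (n - 1)%Z = a n.
Proof.
intros H.
assert (E : sum_n (fun i => INR i * a (n - Z.of_nat i)%Z) p
  - sum_n (fun i => INR i * a (n - 1 - Z.of_nat i)%Z) p
  = sum_n (fun i => a (n - Z.of_nat i)%Z) p - a n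
    - INR p * a (n - 1 - Z.of_nat p)%Z).
{ clear H; induction p as [|p IH].
  - rewrite !sum_O; simpl; rewrite !Z.sub_0_r; ring.
  - rewrite !sum_n_S, S_INR.
    replace (n - Z.of_nat (S p))%Z with (n - 1 - Z.of_nat p)%Z by lia.
    lra. }
(* Both boundary terms are now multiples of [a n], with total [- (p + 1) * a n]. *)
rewrite H, (zero_mean_periodic p a n H) in E.
unfold anti; rewrite <- Rmult_minus_distr_l, E, S_INR.
field; generalize (pos_INR p); lra.
Qed.

Lemma anti_zero_mean (p : nat) (a : Z -> R) :
  zero_mean p a -> zero_mean p (anti p a).
Proof.
intros H n; unfold anti.
rewrite (sum_n_mult_l (K := R_Ring)).
rewrite sum_n_switch.
rewrite (sum_n_ext _ (fun _ => 0)).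
- rewrite sum_n_const; unfold mult; simpl; ring.
- intros i; rewrite <- (Rmult_0_r (INR i)), <- (H (n - Z.of_nat i)%Z).
  rewrite <- (sum_n_mult_l (K := R_Ring)); apply sum_n_ext; intros k.
  unfold mult; simpl; do 2 f_equal; lia.
Qed.

Lemma anti_bounded (p : nat) (a : Z -> R) :
  bounded_seq a -> bounded_seq (anti p a).
Proof.
intros [M HM].
exists (/ INR (S p) * (sum_n INR p * M)); intros n; unfold anti.
assert (0 < / INR (S p)) by (apply Rinv_0_lt_compat, lt_0_INR; lia).
rewrite Rabs_mult, Rabs_Ropp, (Rabs_right (/ _)) by lra.
apply Rmult_le_compat_l; [lra|].
eapply Rle_trans; [apply Rabs_sum_n_le|].
rewrite <- sum_n_scal_r; apply sum_n_m_le; intros i.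
rewrite Rabs_mult, (Rabs_right (INR i)) by (apply Rle_ge, pos_INR).
apply Rmult_le_compat_l; [apply pos_INR|apply HM].
Qed.

Lemma anti_shift (p : nat) (a : Z -> R) :
  anti p (fun n => a (n + 1)%Z) = (fun n => anti p a (n + 1)%Z).
Proof.
apply functional_extensionality; intros n; unfold anti; f_equal.
apply sum_n_ext; intros i; do 2 f_equal; lia.
Qed.

Lemma zero_mean_opp (p : nat) (a : Z -> R) :
  zero_mean p a -> zero_mean p (fun n => a (- n)%Z).
Proof.
intros H n; rewrite <- (H (Z.of_nat p - n)%Z), <- sum_n_rev.
apply sum_n_ext_loc; intros i Hi; f_equal; lia.
Qed.

(** Reflection exchanges forward and backward differences, whence the sign and the shift by one. In
    the proof, reversing one of the two sums makes the weights [i] and [p - i] add up to the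
    constant [p], and the zero mean finishes. *)
Lemma anti_opp (p : nat) (a : Z -> R) : zero_mean p a ->
  anti p (fun n => a (- n)%Z) = (fun n => - anti p a (- n - 1)%Z).
Proof.
intros H; apply functional_extensionality; intros n; unfold anti.
enough (E : sum_n (fun i => INR i * a (- (n - Z.of_nat i))%Z) p
  + sum_n (fun i => INR i * a (- n - 1 - Z.of_nat i)%Z) p = 0)
  by (rewrite Ropp_mult_distr_r; f_equal; lra).
rewrite <- (sum_n_rev (fun i => INR i * a (- n - 1 - Z.of_nat i)%Z)).
rewrite <- (Rmult_0_l (INR p)), <- (zero_mean_opp p a H n), <- sum_n_scal_r.
rewrite <- (sum_n_plus (G := R_AbelianMonoid)).
apply sum_n_ext_loc; intros i Hi; unfold plus; simpl.
rewrite (minus_INR _ _ Hi).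
replace (- n - 1 - Z.of_nat (p - i))%Z
  with (- (n - Z.of_nat i) - 1 - Z.of_nat p)%Z by lia.
rewrite (zero_mean_periodic p a _ H); ring.
Qed.

(** * Iterated summation by parts *)

(** Forward, because summation by parts moves the backward difference inverted by [anti] to a
    forward one on [g]. *)
Definition fdiff (g : R -> R) (x : R) : R := g (x + 1) - g x.

Fixpoint iter_fdiff (m : nat) (g : R -> R) : R -> R :=
  match m with O => g | S m => iter_fdiff m (fdiff g) end.

(* Iterated summation by parts turns [sum_(n >= 1) a n * g n] into the boundary
   terms [ibp_head p m a g] plus the series [ibp_tail p m a g], which only needs
   the [m]-th differences of [g] to be summable. *)
Fixpoint ibp_head (p m : nat) (a : Z -> R) (g : R -> R) : R :=
  match m with
  | O => 0
  | S m => - anti p a 0 * g 1 - ibp_head p m (anti p a) (fdiff g)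
  end.

Definition twisted_sum (a : Z -> R) (g : R -> R) : R :=
  Series (fun k => a (Z.of_nat (S k)) * g (INR (S k))).

Fixpoint ibp_tail (p m : nat) (a : Z -> R) (g : R -> R) : R :=
  match m with
  | O => twisted_sum a g
  | S m => - ibp_tail p m (anti p a) (fdiff g)
  end.

Definition summable (g : R -> R) : Prop :=
  ex_series (fun k => Rabs (g (INR (S k)))).

Lemma summable_fdiff (g : R -> R) : summable g -> summable (fdiff g).
Proof.
intros H; unfold summable.
apply (ex_series_le (V := R_CompleteNormedModule) _
  (fun k => Rabs (g (INR (S (S k)))) + Rabs (g (INR (S k))))).
- intros k; unfold norm; simpl; unfold abs; simpl.
  rewrite Rabs_Rabsolu; unfold fdiff; rewrite <- S_INR.
  unfold Rminus; eapply Rle_trans; [apply Rabs_triang|].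
  rewrite Rabs_Ropp; apply Rle_refl.
- apply (ex_series_plus (V := R_NormedModule)); [|exact H].
  apply (ex_series_incr_1 (V := R_NormedModule) (fun k => Rabs (g (INR (S k))))), H.
Qed.

Lemma ex_twisted (a : Z -> R) (g : R -> R) : bounded_seq a -> summable g ->
  ex_series (fun k => Rabs (a (Z.of_nat (S k)) * g (INR (S k)))).
Proof.
intros [M HM] Hg.
apply (ex_series_le (V := R_CompleteNormedModule) _
  (fun k => M * Rabs (g (INR (S k))))).
- intros k; unfold norm; simpl; unfold abs; simpl.
  rewrite Rabs_Rabsolu, Rabs_mult.
  apply Rmult_le_compat_r; [apply Rabs_pos|apply HM].
- now apply ex_series_mult_l.
Qed.

Lemma twisted_sum_by_parts (p : nat) (a : Z -> R) (g : R -> R) :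
  zero_mean p a -> bounded_seq a -> summable g ->
  twisted_sum a g = - anti p a 0 * g 1 - twisted_sum (anti p a) (fdiff g).
Proof.
intros Hz Hb Hg; apply is_series_unique.
set (c := anti p a).
assert (Hcb : bounded_seq c) by now apply anti_bounded.
(* Abel summation up to [N]. The boundary term at the upper end tends to 0, being a bounded factor
   times a term of a convergent series. *)
assert (E : forall N, sum_n (fun k => a (Z.of_nat (S k)) * g (INR (S k))) N
  = - c 0%Z * g 1 - sum_n (fun k => c (Z.of_nat (S k)) * fdiff g (INR (S k))) N
    + c (Z.of_nat (S N)) * g (INR (S (S N))) :> R).
{ assert (Ha : forall N, a (Z.of_nat (S N)) = c (Z.of_nat (S N)) - c (Z.of_nat N)).
  { intros N; rewrite <- (anti_diff p a _ Hz); unfold c; do 2 f_equal; lia. }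
  induction N as [|N IH].
  - rewrite !sum_O, Ha; unfold fdiff; rewrite <- S_INR.
    change (INR 1) with 1; change (Z.of_nat 0) with 0%Z; ring.
  - rewrite !sum_n_S, IH, Ha; unfold fdiff; rewrite <- S_INR; ring. }
change (is_lim_seq (sum_n (fun k => a (Z.of_nat (S k)) * g (INR (S k))))
  (- c 0%Z * g 1 - twisted_sum c (fdiff g))).
eapply is_lim_seq_ext; [intros N; symmetry; apply E|].
replace (- c 0%Z * g 1 - twisted_sum c (fdiff g))
  with (- c 0%Z * g 1 - twisted_sum c (fdiff g) + 0) by ring.
apply is_lim_seq_plus'.
- apply is_lim_seq_minus'; [apply is_lim_seq_const|].
  apply (Series_correct (fun k => c (Z.of_nat (S k)) * fdiff g (INR (S k)))).
  apply ex_series_Rabs, ex_twisted; [easy|now apply summable_fdiff].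
- apply is_lim_seq_abs_0.
  destruct Hcb as [M HM].
  apply is_lim_seq_le_le with (fun _ => 0) (fun N => M * Rabs (g (INR (S (S N))))).
  + intros N; split; [apply Rabs_pos|rewrite Rabs_mult].
    apply Rmult_le_compat_r; [apply Rabs_pos|apply HM].
  + apply is_lim_seq_const.
  + replace (Finite 0) with (Rbar_mult M 0) by (simpl; f_equal; ring).
    apply is_lim_seq_scal_l.
    apply (is_lim_seq_incr_1 (fun N => Rabs (g (INR (S N))))).
    apply ex_series_lim_0, Hg.
Qed.

Lemma twisted_sum_ibp (p m : nat) (a : Z -> R) (g : R -> R) :
  zero_mean p a -> bounded_seq a -> summable g ->
  twisted_sum a g = ibp_head p m a g + ibp_tail p m a g.
Proof.
revert a g; induction m as [|m IH]; intros a g Hz Hb Hg; simpl; [ring|].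
rewrite (twisted_sum_by_parts p) by assumption.
rewrite (IH (anti p a) (fdiff g)); [ring| | |].
- now apply anti_zero_mean.
- now apply anti_bounded.
- now apply summable_fdiff.
Qed.

(** The coefficients [c] are, up to sign, the [m]-fold antidifference of [a]. They do not depend on
    [g], so every estimate of the tail reduces to one of [iter_fdiff m g]. *)
Lemma ibp_tail_eq (p m : nat) (a : Z -> R) : bounded_seq a ->
  exists c, bounded_seq c /\
    forall g, ibp_tail p m a g = twisted_sum c (iter_fdiff m g).
Proof.
revert a; induction m as [|m IH]; intros a Hb; [now exists a|].
destruct (IH (anti p a) (anti_bounded p a Hb)) as [c [[M HM] Hc]].
exists (fun n => - c n); split.
- exists M; intros n; rewrite Rabs_Ropp; apply HM.
- intros g; simpl; rewrite Hc; unfold twisted_sum.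
  rewrite <- Series_opp; apply Series_ext; intros k; ring.
Qed.

(** [M] is chosen before [g], since [g] will later vary with [t]. *)
Lemma ibp_tail_bound (p m : nat) (a : Z -> R) : bounded_seq a ->
  exists M, 0 <= M /\ forall g, summable (iter_fdiff m g) ->
    Rabs (ibp_tail p m a g)
    <= M * Series (fun k => Rabs (iter_fdiff m g (INR (S k)))).
Proof.
intros Hb; destruct (ibp_tail_eq p m a Hb) as [c [Hcb Hc]].
destruct (Hcb) as [M HM]; exists M; split.
{ apply Rle_trans with (2 := HM 0%Z), Rabs_pos. }
intros g Hg; rewrite Hc; unfold twisted_sum.
eapply Rle_trans; [now apply Series_Rabs, ex_twisted|].
rewrite <- Series_scal_l; apply Series_le.
- intros k; split; [apply Rabs_pos|rewrite Rabs_mult].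
  apply Rmult_le_compat_r; [apply Rabs_pos|apply HM].
- now apply ex_series_mult_l.
Qed.

(** * Polynomials and trivial zeros *)

(** The head samples [g] only at the integers from 1 to [m]. This lets real powers, which are
    meaningful for positive base only, be exchanged for polynomials. *)
Lemma ibp_head_ext (p m : nat) (a : Z -> R) (g h : R -> R) :
  (forall x, 1 <= x -> g x = h x) -> ibp_head p m a g = ibp_head p m a h.
Proof.
revert a g h; induction m as [|m IH]; intros a g h E; simpl; [easy|].
rewrite (E 1) by lra; f_equal; apply IH.
intros x Hx; unfold fdiff; now rewrite !E by lra.
Qed.

Lemma ibp_head_plus (p m : nat) (a : Z -> R) (g h : R -> R) :
  ibp_head p m a (fun x => g x + h x) = ibp_head p m a g + ibp_head p m a h.
Proof.
revert a g h; induction m as [|m IH]; intros a g h; simpl; [ring|].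
rewrite (ibp_head_ext _ _ _ _ (fun x => fdiff g x + fdiff h x)), IH.
- ring.
- intros x _; unfold fdiff; ring.
Qed.

Lemma ibp_head_scal (p m : nat) (a : Z -> R) (c : R) (g : R -> R) :
  ibp_head p m a (fun x => c * g x) = c * ibp_head p m a g.
Proof.
revert a g; induction m as [|m IH]; intros a g; simpl; [ring|].
rewrite (ibp_head_ext _ _ _ _ (fun x => c * fdiff g x)), IH.
- ring.
- intros x _; unfold fdiff; ring.
Qed.

Lemma ibp_head_sum (p m : nat) (a : Z -> R) (g : nat -> R -> R) (N : nat) :
  ibp_head p m a (fun x => sum_n (fun k => g k x) N)
  = sum_n (fun k => ibp_head p m a (g k)) N :> R.
Proof.
induction N as [|N IH].
- rewrite sum_O; apply ibp_head_ext; intros x _; now rewrite sum_O.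
- rewrite sum_n_S, <- IH, <- ibp_head_plus.
  apply ibp_head_ext; intros x _; apply sum_n_S.
Qed.

(** Each difference at most doubles the bound and looks one unit further to the right, hence the
    factor 2 and the range up to [S m]. *)
Lemma ibp_head_bound (p m : nat) (a : Z -> R) :
  exists M, 0 <= M /\ forall g B,
    (forall x, 1 <= x <= INR (S m) -> Rabs (g x) <= B) ->
    Rabs (ibp_head p m a g) <= M * B.
Proof.
revert a; induction m as [|m IH]; intros a.
- exists 0; split; [lra|]; intros g B _; simpl; rewrite Rabs_R0; lra.
- destruct (IH (anti p a)) as [M [HM HI]].
  exists (Rabs (anti p a 0) + M * 2); split.
  { generalize (Rabs_pos (anti p a 0)); lra. }
  intros g B HB; cbn [ibp_head].
  assert (H1 : 1 <= INR (S m)) by (rewrite S_INR; generalize (pos_INR m); lra).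
  rewrite (S_INR (S m)) in HB.
  assert (E : Rabs (ibp_head p m (anti p a) (fdiff g)) <= M * (2 * B)).
  { apply HI; intros x Hx; unfold fdiff, Rminus.
    eapply Rle_trans; [apply Rabs_triang|]; rewrite Rabs_Ropp.
    generalize (HB x) (HB (x + 1)); lra. }
  unfold Rminus; eapply Rle_trans; [apply Rabs_triang|].
  rewrite Rabs_Ropp, Rabs_mult, Rabs_Ropp.
  assert (Rabs (anti p a 0) * Rabs (g 1) <= Rabs (anti p a 0) * B).
  { apply Rmult_le_compat_l; [apply Rabs_pos|apply HB; lra]. }
  lra.
Qed.

Lemma anti_neg (p : nat) (a : Z -> R) :
  anti p (fun n => - a n) = (fun n => - anti p a n).
Proof.
apply functional_extensionality; intros n; unfold anti.
rewrite Ropp_mult_distr_r; f_equal.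
transitivity (sum_n (fun i => INR i * a (n - Z.of_nat i)%Z) p * (-1)); [|lra].
rewrite <- sum_n_scal_r; apply sum_n_ext; intros i.
change (INR i * - a (n - Z.of_nat i)%Z = INR i * a (n - Z.of_nat i)%Z * -1); ring.
Qed.

Lemma ibp_head_neg_neg (p m : nat) (a : Z -> R) (g : R -> R) :
  ibp_head p m (fun n => - a n) (fun x => - g x) = ibp_head p m a g.
Proof.
revert a g; induction m as [|m IH]; intros a g; simpl; [easy|].
rewrite anti_neg.
rewrite (ibp_head_ext _ _ _ (fdiff (fun x => - g x)) (fun x => - fdiff g x)), IH.
- ring.
- intros x _; unfold fdiff; ring.
Qed.

(** When the [m]-th differences vanish there is no tail, and the head acts as a regularised value of
    the divergent sum of [a n * g n] over [n >= 1]; shifting both factors then just drops the term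
    at 1. *)
Lemma ibp_head_shift (p m : nat) (a : Z -> R) (g : R -> R) : zero_mean p a ->
  (forall x, iter_fdiff m g x = 0) ->
  ibp_head p m (fun n => a (n + 1)%Z) (fun x => g (x + 1)) = ibp_head p m a g - a 1%Z * g 1.
Proof.
revert a g; induction m as [|m IH]; intros a g Ha Hg; simpl.
- simpl in Hg; rewrite Hg; ring.
- rewrite anti_shift.
  change (fdiff (fun x => g (x + 1))) with (fun x => fdiff g (x + 1)).
  rewrite (IH (anti p a) (fdiff g)); [|now apply anti_zero_mean|exact Hg].
  rewrite <- (anti_diff p a 1 Ha); unfold fdiff; simpl; ring.
Qed.

(* The regularised sum of a polynomial against a mean zero periodic sequence over
   all of [Z] vanishes. *)
Lemma ibp_head_reflect (p m : nat) (a : Z -> R) (g : R -> R) : zero_mean p a ->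
  (forall x, iter_fdiff m g x = 0) ->
  ibp_head p m a g + a 0%Z * g 0 + ibp_head p m (fun n => a (- n)%Z) (fun x => g (- x)) = 0.
Proof.
revert a g; induction m as [|m IH]; intros a g Ha Hg; simpl.
- simpl in Hg; rewrite Hg; ring.
- set (c := anti p a).
  assert (Hc : zero_mean p c) by now apply anti_zero_mean.
  assert (I1 := IH c (fdiff g) Hc Hg).
  (* Differencing the reflected data yields the reflections of [c] and [fdiff g], both shifted by
     one. Undoing this shift costs the term at index 1, that is, the one at -1 before reflection. *)
  assert (I2 := ibp_head_shift p m (fun n => c (- n)%Z) (fun x => fdiff g (- x))
    (zero_mean_opp p c Hc)).
  rewrite anti_opp by easy; fold c.
  rewrite (ibp_head_ext _ _ _ (fdiff (fun x => g (- x))) (fun x => - fdiff g (- (x + 1)))).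
  2: { intros x _; unfold fdiff; cbv beta; replace (- (x + 1) + 1) with (- x) by ring; ring. }
  replace (fun n => - c (- n - 1)%Z) with (fun n => - c (- (n + 1))%Z).
  2: { apply functional_extensionality; intros n; do 2 f_equal; lia. }
  rewrite ibp_head_neg_neg with (g := fun x => fdiff g (- (x + 1))).
  rewrite I2.
  + rewrite <- (anti_diff p a 0 Ha); fold c.
    change (- (0) - 1)%Z with (-1)%Z; change (0 - 1)%Z with (-1)%Z.
    change (- (1))%Z with (-1)%Z.
    replace (fdiff g (- (1))) with (g 0 - g (- (1))) by (unfold fdiff; now rewrite Rplus_opp_l).
    replace (fdiff g 0) with (g 1 - g 0) in I1 by (unfold fdiff; now rewrite Rplus_0_l).
    lra.
  + clear - Hg; simpl in Hg; revert Hg; generalize (fdiff g); clear g.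
    (* Reflection turns a forward difference into minus a backward one; [m] of them give the sign
       and the displacement by [m]. *)
    assert (R : forall g x, iter_fdiff m (fun x => g (- x)) x
      = (-1) ^ m * iter_fdiff m g (- x - INR m)).
    { induction m as [|m IH]; intros g x; cbn [iter_fdiff].
      - simpl; rewrite Rmult_1_l; f_equal; ring.
      - assert (E : fdiff (fun x => g (- x)) = fun x => (fun y => - fdiff g (y - 1)) (- x)).
        { apply functional_extensionality; intros y; unfold fdiff.
          replace (- y - 1 + 1) with (- y) by ring.
          replace (- (y + 1)) with (- y - 1) by ring; ring. }
        rewrite E, (IH (fun y => - fdiff g (y - 1))), S_INR; clear.
        assert (E : forall g x, iter_fdiff m (fun y => - g (y - 1)) x
          = - iter_fdiff m g (x - 1)).
        { clear; induction m as [|m IH]; intros g x; cbn [iter_fdiff]; [easy|].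
          rewrite <- IH; f_equal; apply functional_extensionality; intros y.
          unfold fdiff; replace (y + 1 - 1) with (y - 1 + 1) by ring; ring. }
        rewrite E; replace (- x - INR m - 1) with (- x - (INR m + 1)) by ring.
        simpl; ring. }
    intros g Hg x; rewrite R, Hg; ring.
Qed.

Lemma iter_fdiff_plus (m : nat) (g h : R -> R) (x : R) :
  iter_fdiff m (fun x => g x + h x) x = iter_fdiff m g x + iter_fdiff m h x.
Proof.
revert g h; induction m as [|m IH]; intros g h; cbn [iter_fdiff]; [easy|].
rewrite <- IH; f_equal; apply functional_extensionality; intros y.
unfold fdiff; ring.
Qed.

Lemma iter_fdiff_shift (m : nat) (g : R -> R) (x : R) :
  iter_fdiff m (fun x => g (x + 1)) x = iter_fdiff m g (x + 1).
Proof.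
revert g; induction m as [|m IH]; intros g; cbn [iter_fdiff]; [easy|].
rewrite <- IH; reflexivity.
Qed.

(** Discrete Leibniz rule: the difference of [y * g y] is [y * fdiff g y + g (y + 1)], so
    multiplication by the variable raises the degree by one. *)
Lemma iter_fdiff_mul_id (m : nat) (g : R -> R) :
  (forall x, iter_fdiff m g x = 0) -> forall x, iter_fdiff (S m) (fun y => y * g y) x = 0.
Proof.
revert g; induction m as [|m IH]; intros g Hg x.
- simpl in *; unfold fdiff; rewrite !Hg; ring.
- change (iter_fdiff (S m) (fdiff (fun y => y * g y)) x = 0).
  assert (E : fdiff (fun y => y * g y) = fun y => y * fdiff g y + g (y + 1)).
  { apply functional_extensionality; intros y; unfold fdiff; ring. }
  rewrite E, iter_fdiff_plus, iter_fdiff_shift, Hg, (IH (fdiff g)); [ring|exact Hg].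
Qed.

Lemma iter_fdiff_pow (k j : nat) (x : R) :
  iter_fdiff (S (j + k)) (fun y => y ^ k) x = 0.
Proof.
revert x; induction k as [|k IH]; intros x.
- rewrite Nat.add_0_r; cbn [iter_fdiff].
  replace (fdiff (fun y => y ^ 0)) with (fun _ : R => 0)
    by (apply functional_extensionality; intros y; unfold fdiff; simpl; ring).
  induction j as [|j IH]; [easy|]; cbn [iter_fdiff].
  replace (fdiff (fun _ => 0)) with (fun _ : R => 0); [easy|].
  apply functional_extensionality; intros y; unfold fdiff; ring.
- rewrite Nat.add_succ_r; exact (iter_fdiff_mul_id _ _ IH x).
Qed.

(** By parity the two heads in the reflection identity coincide, so twice the head is minus the term
    at 0. That term needs [a 0 = 0] when [k = 0], as [0 ^ 0 = 1]. *)
Lemma ibp_head_pow_even (p j k : nat) (a : Z -> R) :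
  zero_mean p a -> a 0%Z = 0 -> (forall n, a (- n)%Z = a n) -> Nat.even k = true ->
  ibp_head p (S (j + k)) a (fun x => x ^ k) = 0.
Proof.
intros Ha H0 He Hk.
assert (I := ibp_head_reflect p _ a _ Ha (iter_fdiff_pow k j)).
replace (fun n => a (- n)%Z) with a in I
  by (apply functional_extensionality; intros n; now rewrite He).
apply Nat.even_spec in Hk; destruct Hk as [l ->].
rewrite (ibp_head_ext _ _ _ (fun x => (- x) ^ (2 * l)) (fun x => x ^ (2 * l))) in I.
- rewrite H0 in I; lra.
- intros x _; rewrite !pow_mult; f_equal; ring.
Qed.

Lemma ibp_head_pow_odd (p j k : nat) (a : Z -> R) :
  zero_mean p a -> a 0%Z = 0 -> (forall n, a (- n)%Z = - a n) -> Nat.odd k = true ->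
  ibp_head p (S (j + k)) a (fun x => x ^ k) = 0.
Proof.
intros Ha H0 He Hk.
assert (I := ibp_head_reflect p _ a _ Ha (iter_fdiff_pow k j)).
replace (fun n => a (- n)%Z) with (fun n => - a n) in I
  by (apply functional_extensionality; intros n; now rewrite He).
apply Nat.odd_spec in Hk; destruct Hk as [l ->].
rewrite (ibp_head_ext _ _ _ (fun x => (- x) ^ (2 * l + 1)) (fun x => - x ^ (2 * l + 1))) in I.
- rewrite ibp_head_neg_neg in I; rewrite H0 in I; lra.
- intros x _; rewrite !pow_add, !pow_mult.
  replace ((- x) ^ 2) with (x ^ 2) by ring; ring.
Qed.

(** * Differences and double series *)

(** A discrete integral test with an explicit bound on the sum; that bound will have to be uniform
    in [t]. *)
Lemma telescoping_series (u phi : nat -> R) :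
  (forall k, 0 <= u k <= phi k - phi (S k)) -> (forall k, 0 <= phi k) ->
  ex_series u /\ Series u <= phi O.
Proof.
intros Hu Hphi.
assert (B : forall n, sum_n u n <= phi O - phi (S n)).
{ induction n as [|n IH]; [rewrite sum_O; apply Hu|].
  rewrite sum_n_S; generalize (Hu (S n)); lra. }
assert (Hex : ex_series u).
{ destruct (ex_finite_lim_seq_incr (sum_n u) (phi O)) as [l Hl].
  - intros n; rewrite sum_n_S; generalize (Hu (S n)); lra.
  - intros n; generalize (B n) (Hphi (S n)); lra.
  - now exists l. }
split; [exact Hex|].
apply (is_lim_seq_le (sum_n u) (fun _ => phi O) (Series u) (phi O)).
- intros n; generalize (B n) (Hphi (S n)); lra.
- exact (Series_correct u Hex).
- apply is_lim_seq_const.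
Qed.

Lemma ex_series_inv_sqr : ex_series (fun k => / INR (S k) ^ 2).
Proof.
(* The factor 2 absorbs the ratio [(k + 2) / (k + 1) <= 2] between [1 / (k + 1) ^ 2] and the
   telescoping [1 / ((k + 1) * (k + 2))]. *)
apply (telescoping_series _ (fun k => 2 * / INR (S k))).
- intros k; rewrite !S_INR; generalize (pos_INR k); intros H; split.
  + left; apply Rinv_0_lt_compat, pow_lt; lra.
  + replace (2 * / (INR k + 1) - 2 * / (INR k + 1 + 1))
      with (2 * (/ (INR k + 1) * / (INR k + 2))) by (field; lra).
    simpl; rewrite Rmult_1_r, Rinv_mult.
    assert (0 < / (INR k + 1)) by (apply Rinv_0_lt_compat; lra).
    assert (/ (INR k + 1) <= 2 * / (INR k + 2)).
    { apply Rmult_le_reg_l with ((INR k + 1) * (INR k + 2)); [nra|].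
      replace ((INR k + 1) * (INR k + 2) * / (INR k + 1)) with (INR k + 2) by (field; lra).
      replace ((INR k + 1) * (INR k + 2) * (2 * / (INR k + 2)))
        with (2 * (INR k + 1)) by (field; lra); lra. }
    nra.
- intros k; assert (0 < / INR (S k)) by (apply Rinv_0_lt_compat, lt_0_INR; lia); lra.
Qed.

Lemma summable_inv_sqr (g : R -> R) (K : R) :
  (forall x, 1 <= x -> Rabs (g x) <= K * / x ^ 2) -> summable g.
Proof.
intros H; unfold summable.
apply (ex_series_le (V := R_CompleteNormedModule) _ (fun k => K * / INR (S k) ^ 2)).
- intros k; unfold norm; simpl; unfold abs; simpl; rewrite Rabs_Rabsolu; apply H.
  change (1 <= INR (S k)); rewrite S_INR; generalize (pos_INR k); lra.
- apply ex_series_mult_l, ex_series_inv_sqr.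
Qed.

(** Derivatives come as an explicit family, so differentiation is a shift of the index. The
    half-line accommodates logarithms and real powers. *)
Definition deriv_tower (G : nat -> R -> R) : Prop :=
  forall k x, 0 < x -> is_derive (G k) x (G (S k) x).

Lemma is_derive_continuity_pt (f : R -> R) (x l : R) :
  is_derive f x l -> continuity_pt f x.
Proof.
intros H; apply continuity_pt_filterlim, (ex_derive_continuous f); now exists l.
Qed.

(** Differences commute with derivatives, so the mean value theorem trades the unit differences one
    by one for derivatives, each widening the interval by one. *)
Lemma iter_fdiff_bound (m : nat) (G : nat -> R -> R) (x B : R) :
  deriv_tower G -> 0 < x -> (forall y, x <= y <= x + INR m -> Rabs (G m y) <= B) ->
  Rabs (iter_fdiff m (G O) x) <= B.
Proof.
revert G; induction m as [|m IH]; intros G HG Hx HB; cbn [iter_fdiff].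
- apply HB; simpl; lra.
- apply (IH (fun k => fdiff (G k))); [|exact Hx|].
  + intros k y Hy; unfold fdiff.
    apply (is_derive_minus (fun z => G k (z + 1)) (G k)); [|now apply HG].
    rewrite <- (Rmult_1_l (G (S k) (y + 1))).
    apply (is_derive_comp (G k) (fun z => z + 1)).
    * apply HG; lra.
    * auto_derive; [easy|ring].
  + intros y Hy; rewrite S_INR in HB; generalize (pos_INR m); intros Hm.
    destruct (MVT_gen (G m) y (y + 1) (G (S m))) as [c [Hc E]].
    * intros z Hz; rewrite Rmin_left in Hz by lra; apply HG; lra.
    * intros z Hz; rewrite Rmin_left in Hz by lra.
      apply is_derive_continuity_pt with (G (S m) z), HG; lra.
    * rewrite Rmin_left, Rmax_right in Hc by lra.
      unfold fdiff; rewrite E; replace (y + 1 - y) with 1 by ring.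
      rewrite Rmult_1_r; apply HB; lra.
Qed.

Lemma Series_remainder_bound (f B : nat -> R) (J : nat) :
  (forall j, Rabs (f j) <= B j) -> ex_series B ->
  Rabs (Series f - sum_n f J) <= Series B - sum_n B J.
Proof.
intros H HB.
assert (Hf : ex_series (fun j => Rabs (f j))).
{ apply (ex_series_le (V := R_CompleteNormedModule) _ B); [|easy].
  intros j; unfold norm; simpl; unfold abs; simpl; now rewrite Rabs_Rabsolu. }
rewrite (Series_incr_n f (S J)), (Series_incr_n B (S J));
  [|lia|easy|lia|now apply ex_series_Rabs].
rewrite <- !sum_n_Reals; cbn [Nat.pred].
replace (sum_n f J + Series (fun k => f (S J + k)%nat) - sum_n f J)
  with (Series (fun k => f (S J + k)%nat)) by ring.
replace (sum_n B J + Series (fun k => B (S J + k)%nat) - sum_n B J)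
  with (Series (fun k => B (S J + k)%nat)) by ring.
eapply Rle_trans; [apply Series_Rabs|apply Series_le].
- now apply (ex_series_incr_n (V := R_NormedModule) (fun j => Rabs (f j)) (S J)).
- intros k; split; [apply Rabs_pos|apply H].
- now apply (ex_series_incr_n (V := R_NormedModule) B (S J)).
Qed.

(** Fubini from a product majorant: the inner remainder after [J] is at most [A n] times the tail of
    [B], and summed over [n] this still tends to 0. *)
Lemma is_series_swap (u : nat -> nat -> R) (A B : nat -> R) :
  (forall n j, Rabs (u n j) <= A n * B j) -> ex_series A -> ex_series B ->
  is_series (fun j => Series (fun n => u n j))
    (Series (fun n => Series (fun j => u n j))).
Proof.
intros H HA HB.
assert (HAB : forall j, ex_series (fun n => A n * B j)).
{ intros j; apply ex_series_ext with (fun n => B j * A n); [intros; real_ring|].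
  now apply ex_series_mult_l. }
assert (Hu : forall j, ex_series (fun n => u n j)).
{ intros j; apply (ex_series_le (V := R_CompleteNormedModule) _ (fun n => A n * B j)); [|easy].
  intros n; apply H. }
assert (Hsum : forall J, ex_series (fun n => sum_n (u n) J)
  /\ Series (fun n => sum_n (u n) J) = sum_n (fun j => Series (fun n => u n j)) J).
{ induction J as [|J [IH1 IH2]].
  - rewrite sum_O; split.
    + apply ex_series_ext with (fun n => u n O); [intros n; now rewrite sum_O|easy].
    + apply Series_ext; intros n; now rewrite sum_O.
  - rewrite sum_n_S, <- IH2, <- (Series_plus _ _ IH1 (Hu (S J))); split.
    + apply ex_series_ext with (fun n => sum_n (u n) J + u n (S J)).
      { intros n; now rewrite sum_n_S. }
      now apply (ex_series_plus (V := R_NormedModule)).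
    + apply Series_ext; intros n; apply sum_n_S. }
assert (HBn : forall n, ex_series (fun j => A n * B j))
  by (intros n; now apply ex_series_mult_l).
assert (HrA : forall n J, Rabs (Series (u n) - sum_n (u n) J)
  <= (Series B - sum_n B J) * A n).
{ intros n J.
  eapply Rle_trans; [apply (Series_remainder_bound _ _ J (H n) (HBn n))|].
  rewrite Series_scal_l; right.
  assert (E : sum_n (fun j => A n * B j) J = A n * sum_n B J)
    by apply (sum_n_mult_l (K := R_Ring)).
  rewrite E; ring. }
assert (HU : forall J, ex_series (fun n => Rabs (Series (u n) - sum_n (u n) J))).
{ intros J; apply (ex_series_le (V := R_CompleteNormedModule) _
    (fun n => (Series B - sum_n B J) * A n)).
  - intros n; unfold norm; simpl; unfold abs; simpl; rewrite Rabs_Rabsolu; apply HrA.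
  - now apply ex_series_mult_l. }
assert (Hex : ex_series (fun n => Series (u n))).
{ apply ex_series_ext with (fun n => (Series (u n) - sum_n (u n) O) + sum_n (u n) O).
  - intros n; change (Series (u n) - sum_n (u n) O + sum_n (u n) O = Series (u n)); ring.
  - apply (ex_series_plus (V := R_NormedModule)); [apply ex_series_Rabs, HU|apply Hsum]. }
change (is_lim_seq (sum_n (fun j => Series (fun n => u n j)))
  (Series (fun n => Series (u n)))).
apply is_lim_seq_ext with (fun J => Series (fun n => Series (u n))
  - Series (fun n => Series (u n) - sum_n (u n) J)).
{ intros J; destruct (Hsum J) as [E1 E2]; rewrite <- E2, Series_minus by easy; ring. }
replace (Finite (Series (fun n => Series (u n))))
  with (Finite (Series (fun n => Series (u n)) - 0)) by (f_equal; ring).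
apply is_lim_seq_minus'; [apply is_lim_seq_const|].
apply is_lim_seq_abs_0.
apply is_lim_seq_le_le
  with (fun _ => 0) (fun J => (Series B - sum_n B J) * Series A).
- intros J; split; [apply Rabs_pos|].
  eapply Rle_trans; [apply Series_Rabs, HU|].
  rewrite <- Series_scal_l; apply Series_le.
  + intros n; split; [apply Rabs_pos|apply HrA].
  + now apply ex_series_mult_l.
- apply is_lim_seq_const.
- replace (Finite 0) with (Finite ((Series B - Series B) * Series A)) by (f_equal; ring).
  apply is_lim_seq_mult'; [|apply is_lim_seq_const].
  apply is_lim_seq_minus'; [apply is_lim_seq_const|exact (Series_correct B HB)].
Qed.

(** * Analytic continuation on the real line *)

(* [m]-th derivative of [x ^ (- b) * (- ln x) ^ j / j!], the [j]-th Taylor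
   coefficient in [s] at [s = b] of [x ^ (- s)]. *)
Fixpoint log_power (m : nat) (b : R) (j : nat) (x : R) : R :=
  match m with
  | O => Rpower x (- b) * ((- ln x) ^ j / INR (fact j))
  | S m => - b * log_power m (b + 1) j x
           - match j with O => 0 | S i => log_power m (b + 1) i x end
  end.

Lemma log_power_tower (b : R) (j : nat) : deriv_tower (fun m => log_power m b j).
Proof.
intros m; revert b j; induction m as [|m IH]; intros b j x Hx.
- assert (E : Rpower x (- (b + 1)) = Rpower x (- b) * / x).
  { replace (- (b + 1)) with (- b + - (1)) by ring.
    rewrite Rpower_plus, (Rpower_Ropp x 1), Rpower_1 by easy; easy. }
  assert (D : is_derive (fun x => Rpower x (- b)) x (- b * (Rpower x (- b) * / x))).
  { unfold Rpower; auto_derive; [easy|]; field; lra. }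
  assert (Dl : is_derive (fun x => (- ln x) ^ j / INR (fact j)) x
    (match j with O => 0 | S i => - / x * ((- ln x) ^ i / INR (fact i)) end)).
  { destruct j as [|i].
    - simpl; auto_derive; [easy|]; ring.
    - assert (F : INR (fact (S i)) = INR (S i) * INR (fact i))
        by now rewrite fact_simpl, mult_INR.
      assert (Hi : INR (S i) <> 0) by (apply not_0_INR; lia).
      apply is_derive_ext with (fun x => / INR (fact (S i)) * (- ln x) ^ S i).
      { intros y; unfold Rdiv; real_ring. }
      evar_last.
      { apply is_derive_scal, (is_derive_pow (fun x => - ln x) (S i)).
        apply (is_derive_opp ln); now apply is_derive_ln. }
      rewrite F; unfold opp; cbn [Nat.pred].
      assert (Hf := INR_fact_neq_0 i).
      change (/ (INR (S i) * INR (fact i)) * (INR (S i) * - / x * (- ln x) ^ i)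
        = - / x * ((- ln x) ^ i / INR (fact i))).
      field; repeat split; (easy || lra). }
  assert (D2 := is_derive_mult _ _ x _ _ D Dl Rmult_comm).
  cbn [log_power].
  evar_last; [exact D2|].
  unfold plus, mult; simpl; rewrite E; destruct j; ring.
- cbn [log_power].
  apply (is_derive_minus (fun x => - b * log_power m (b + 1) j x)
    (fun x => match j with O => 0 | S i => log_power m (b + 1) i x end)).
  + apply is_derive_scal, IH; easy.
  + destruct j as [|i].
    * apply (is_derive_const (K := R_AbsRing) (V := R_NormedModule) 0).
    * now apply IH.
Qed.

Lemma pow_div_fact_le_exp (y : R) (j : nat) : 0 <= y -> y ^ j / INR (fact j) <= exp y.
Proof.
intros Hy; eapply Rle_trans; [|apply (exp_ge_taylor y j Hy)].
assert (H : forall k, 0 <= y ^ k / INR (fact k)).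
{ intros k; apply Rmult_le_pos; [now apply pow_le|].
  left; apply Rinv_0_lt_compat, INR_fact_lt_0. }
destruct j as [|j]; [simpl; lra|].
cbn [sum_f_R0].
assert (0 <= sum_f_R0 (fun k => y ^ k / INR (fact k)) j)
  by (now apply cond_pos_sum).
lra.
Qed.

(* Cauchy-type estimate: the bound on the [j]-th coefficient is geometric of
   ratio [/ r], at the price of a factor [x ^ r]. *)
Lemma log_power_bound (m : nat) (b r : R) : 0 < r ->
  exists K, 0 <= K /\ forall j x, 1 <= x ->
    Rabs (log_power m b j x) * r ^ j <= K * Rpower x (- (b + INR m - r)).
Proof.
intros Hr; revert b; induction m as [|m IH]; intros b.
- exists 1; split; [lra|]; intros j x Hx; cbn [log_power].
  assert (Hl : 0 <= ln x) by (rewrite <- ln_1; apply ln_le; lra).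
  rewrite Rabs_mult, (Rabs_right (Rpower _ _)) by (left; apply exp_pos).
  replace (- (b + INR 0 - r)) with (- b + r) by (simpl; ring).
  rewrite Rpower_plus, Rmult_1_l, Rmult_assoc.
  apply Rmult_le_compat_l; [left; apply exp_pos|].
  unfold Rdiv; rewrite Rabs_mult, <- RPow_abs, Rabs_Ropp, (Rabs_right (ln x)) by lra.
  rewrite Rabs_right.
  2: { left; apply Rinv_0_lt_compat, INR_fact_lt_0. }
  replace (ln x ^ j * / INR (fact j) * r ^ j) with ((r * ln x) ^ j / INR (fact j))
    by (rewrite Rpow_mult_distr; unfold Rdiv; ring).
  apply pow_div_fact_le_exp; nra.
- destruct (IH (b + 1)) as [K [HK H]].
  exists (Rabs b * K + r * K); split.
  { generalize (Rabs_pos b); nra. }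
  intros j x Hx; cbn [log_power].
  rewrite S_INR; replace (b + (INR m + 1) - r) with (b + 1 + INR m - r) by ring.
  set (X := Rpower x _) in *.
  assert (HX : 0 < X) by apply exp_pos.
  assert (H1 : Rabs (- b * log_power m (b + 1) j x) * r ^ j <= Rabs b * K * X).
  { rewrite Rabs_mult, Rabs_Ropp, !Rmult_assoc.
    apply Rmult_le_compat_l; [apply Rabs_pos|now apply H]. }
  assert (H2 : Rabs (match j with O => 0 | S i => log_power m (b + 1) i x end) * r ^ j
    <= r * K * X).
  { destruct j as [|i].
    - rewrite Rabs_R0, Rmult_0_l; apply Rmult_le_pos; nra.
    - assert (E := H i x Hx); fold X in E.
      replace (Rabs (log_power m (b + 1) i x) * r ^ S i)
        with (r * (Rabs (log_power m (b + 1) i x) * r ^ i)) by (simpl; ring).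
      rewrite Rmult_assoc; apply Rmult_le_compat_l; [lra|exact E]. }
  assert (Hrj : 0 < r ^ j) by now apply pow_lt.
  unfold Rminus; rewrite Rmult_plus_distr_r.
  eapply Rle_trans; [apply Rmult_le_compat_r; [lra|apply Rabs_triang]|].
  rewrite Rabs_Ropp; lra.
Qed.

Lemma Rpower_expansion (b h x : R) :
  is_series (fun j => log_power 0 b j x * h ^ j) (Rpower x (- (b + h))).
Proof.
replace (- (b + h)) with (- b + - h) by ring; rewrite Rpower_plus.
assert (H := proj1 (is_pseries_R _ _ _) (is_exp_Reals (- h * ln x))).
apply (is_series_scal_l (K := R_AbsRing) (Rpower x (- b))) in H.
eapply is_series_ext; [|exact H].
intros j; change (Rpower x (- b) * (/ INR (fact j) * (- h * ln x) ^ j)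
  = Rpower x (- b) * ((- ln x) ^ j / INR (fact j)) * h ^ j).
replace (- h * ln x) with (- ln x * h) by ring; rewrite Rpow_mult_distr.
unfold Rdiv; ring.
Qed.

Lemma is_series_lin (u v : nat -> R) (c d lu lv : R) :
  is_series u lu -> is_series v lv ->
  is_series (fun n => c * u n + d * v n) (c * lu + d * lv).
Proof.
intros Hu Hv.
apply (is_series_plus (V := R_NormedModule) (fun n => c * u n) (fun n => d * v n)).
- exact (is_series_scal_l (V := R_NormedModule) c u lu Hu).
- exact (is_series_scal_l (V := R_NormedModule) d v lv Hv).
Qed.

Lemma iter_fdiff_series (m : nat) (gam : nat -> R -> R) (g : R -> R) (h x : R) :
  (forall x, is_series (fun j => gam j x * h ^ j) (g x)) ->
  is_series (fun j => iter_fdiff m (gam j) x * h ^ j) (iter_fdiff m g x).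
Proof.
revert gam g; induction m as [|m IH]; intros gam g H; cbn [iter_fdiff]; [easy|].
apply (IH (fun j => fdiff (gam j))); intros y.
replace (fdiff g y) with (1 * g (y + 1) + (-1) * g y) by (unfold fdiff; ring).
eapply is_series_ext; [|apply is_series_lin; apply H].
intros j; unfold fdiff; real_ring.
Qed.

Lemma ibp_head_series (p m : nat) (a : Z -> R) (gam : nat -> R -> R) (g : R -> R) (h : R) :
  (forall x, is_series (fun j => gam j x * h ^ j) (g x)) ->
  is_series (fun j => ibp_head p m a (gam j) * h ^ j) (ibp_head p m a g).
Proof.
revert a gam g; induction m as [|m IH]; intros a gam g H; cbn [ibp_head].
- assert (Z := is_series_lin _ _ 0 0 _ _ (H 0) (H 0)).
  rewrite !Rmult_0_l, Rplus_0_r in Z.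
  eapply is_series_ext; [|exact Z]; intros j; real_ring.
- replace (- anti p a 0 * g 1 - ibp_head p m (anti p a) (fdiff g))
    with (- anti p a 0 * g 1 + (-1) * ibp_head p m (anti p a) (fdiff g)) by ring.
  eapply is_series_ext.
  2: { apply is_series_lin; [apply (H 1)|].
       apply (IH (anti p a) (fun j => fdiff (gam j))); intros x.
       exact (iter_fdiff_series 1 gam g h x H). }
  intros j; real_ring.
Qed.

Lemma Rpower_neg2 (x : R) : 0 < x -> Rpower x (- (2)) = / x ^ 2.
Proof.
intros Hx; rewrite Rpower_Ropp; f_equal.
rewrite <- Rpower_pow by easy; reflexivity.
Qed.

Lemma Rpower_antitone (x y b : R) : 0 <= b -> 0 < x <= y -> Rpower y (- b) <= Rpower x (- b).
Proof.
intros Hb Hxy; unfold Rpower.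
assert (ln x <= ln y) by (apply ln_le; lra).
destruct (Rle_lt_or_eq_dec (- b * ln y) (- b * ln x)) as [H'|E]; [nra| |].
- left; now apply exp_increasing.
- rewrite E; lra.
Qed.

(** The candidate continuation: it agrees with the Dirichlet series for [s >= 2] and is real
    analytic for [s > 2 - m]. *)
Definition regularised_dirichlet (p m : nat) (a : Z -> R) (s : R) : R :=
  ibp_head p m a (fun x => Rpower x (- s)) + ibp_tail p m a (fun x => Rpower x (- s)).

Lemma regularised_dirichlet_series (p m : nat) (a : Z -> R) (s0 h : R) :
  bounded_seq a -> Rabs h < s0 + INR m - 2 ->
  is_series (fun j => (ibp_head p m a (log_power 0 s0 j)
                       + ibp_tail p m a (log_power 0 s0 j)) * h ^ j)
    (regularised_dirichlet p m a (s0 + h)).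
Proof.
(* The largest [r] for which the bound on [log_power m] is still [O(x ^ (- 2))], hence summable over
   the integers. *)
intros Hb Hh; set (r := s0 + INR m - 2) in *.
assert (Hr : 0 < r) by (generalize (Rabs_pos h); lra).
assert (Hexp := fun x => Rpower_expansion s0 h x).
unfold regularised_dirichlet.
set (g := fun x => Rpower x (- (s0 + h))) in *.
rewrite <- (Rmult_1_l (ibp_head _ _ _ g)), <- (Rmult_1_l (ibp_tail _ _ _ g)).
apply is_series_ext with (fun j => 1 * (ibp_head p m a (log_power 0 s0 j) * h ^ j)
  + 1 * (ibp_tail p m a (log_power 0 s0 j) * h ^ j)); [intros; real_ring|].
apply is_series_lin; [now apply ibp_head_series|].
destruct (ibp_tail_eq p m a Hb) as [c [[M HM] Hc]].
destruct (log_power_bound m s0 r Hr) as [K [HK HKb]].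
rewrite Hc; unfold twisted_sum.
set (u := fun n j => c (Z.of_nat (S n)) * (iter_fdiff m (log_power 0 s0 j) (INR (S n)) * h ^ j)).
assert (S : is_series (fun j => Series (fun n => u n j))
    (Series (fun n => Series (fun j => u n j)))).
(* The majorant separates: inverse squares in [n], and a geometric series in [j] that converges
   because [Rabs h < r]. *)
{ apply (is_series_swap _ (fun n => M * (K * / INR (S n) ^ 2)) (fun j => (Rabs h / r) ^ j)).
  - intros n j; unfold u; rewrite Rabs_mult, !Rmult_assoc.
    apply Rmult_le_compat; [apply Rabs_pos|apply Rabs_pos|apply HM|].
    assert (Hrj : 0 < r ^ j) by now apply pow_lt.
    rewrite Rabs_mult, <- RPow_abs.
    unfold Rdiv; rewrite Rpow_mult_distr, pow_inv, <- !Rmult_assoc.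
    rewrite (Rmult_assoc _ (Rabs h ^ j)), (Rmult_comm (Rabs h ^ j)), <- Rmult_assoc.
    apply Rmult_le_compat_r; [apply pow_le, Rabs_pos|].
    apply Rmult_le_reg_r with (r ^ j); [easy|].
    rewrite (Rmult_assoc _ (/ r ^ j)), Rinv_l, Rmult_1_r by lra.
    assert (Hn : 1 <= INR (S n)) by (rewrite S_INR; generalize (pos_INR n); lra).
    apply Rmult_le_reg_r with (/ r ^ j); [now apply Rinv_0_lt_compat|].
    rewrite Rmult_assoc, Rinv_r, Rmult_1_r by lra.
    apply (iter_fdiff_bound m (fun k => log_power k s0 j)); [apply log_power_tower|lra|].
    intros y Hy; apply Rmult_le_reg_r with (r ^ j); [easy|].
    rewrite Rmult_assoc, Rinv_l, Rmult_1_r by lra.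
    eapply Rle_trans; [apply HKb; lra|].
    rewrite <- Rpower_neg2 by lra.
    replace (s0 + INR m - r) with 2 by (unfold r; ring).
    apply Rmult_le_compat_l; [easy|apply Rpower_antitone; lra].
  - apply ex_series_mult_l, ex_series_mult_l, ex_series_inv_sqr.
  - apply ex_series_geom; rewrite Rabs_right.
    + apply Rmult_lt_reg_r with r; [easy|]; unfold Rdiv.
      rewrite Rmult_assoc, Rinv_l by lra; lra.
    + apply Rle_ge, Rmult_le_pos; [apply Rabs_pos|left; now apply Rinv_0_lt_compat]. }
erewrite Series_ext.
- eapply is_series_ext; [|exact S].
  intros j; cbv beta; rewrite Hc; unfold twisted_sum, u.
  rewrite <- Series_scal_r; apply Series_ext; intros n; ring.
- intros n; unfold u; symmetry.
  rewrite Series_scal_l; f_equal; apply is_series_unique.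
  now apply iter_fdiff_series.
Qed.

Lemma summable_Rpower (s : R) : 2 <= s -> summable (fun x => Rpower x (- s)).
Proof.
intros Hs; apply summable_inv_sqr with 1; intros x Hx.
rewrite Rabs_right by (left; apply exp_pos).
rewrite Rmult_1_l, <- Rpower_neg2 by lra.
destruct (Rle_lt_or_eq_dec _ _ Hx) as [H|<-].
- apply Rle_Rpower; lra.
- unfold Rpower; rewrite ln_1, !Rmult_0_r; lra.
Qed.

Lemma regularised_dirichlet_eq (p m : nat) (a : Z -> R) (s : R) :
  zero_mean p a -> bounded_seq a -> 2 <= s ->
  regularised_dirichlet p m a s = twisted_sum a (fun x => Rpower x (- s)).
Proof.
intros Hz Hb Hs; symmetry; apply twisted_sum_ibp; [easy..|].
now apply summable_Rpower.
Qed.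

Lemma iter_fdiff_ext (m : nat) (f g : R -> R) (x : R) :
  (forall x, 0 < x -> f x = g x) -> 0 < x -> iter_fdiff m f x = iter_fdiff m g x.
Proof.
revert f g; induction m as [|m IH]; intros f g E Hx; [now apply E|].
apply IH; [|easy]; intros y Hy; unfold fdiff; now rewrite !E by lra.
Qed.

(** At [s = - k] the power is a polynomial of degree [k < m], so its [m]-th differences and with
    them the tail vanish. *)
Lemma regularised_dirichlet_neg (p k j : nat) (a : Z -> R) :
  bounded_seq a ->
  regularised_dirichlet p (S (j + k)) a (- INR k)
  = ibp_head p (S (j + k)) a (fun x => x ^ k).
Proof.
intros Hb; unfold regularised_dirichlet.
assert (E : forall x, 0 < x -> Rpower x (- - INR k) = x ^ k).
{ intros x Hx; rewrite Ropp_involutive; now apply Rpower_pow. }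
rewrite (ibp_head_ext _ _ _ _ (fun x => x ^ k)) by (intros; apply E; lra).
destruct (ibp_tail_eq p (S (j + k)) a Hb) as [c [_ Hc]]; rewrite Hc.
unfold twisted_sum; rewrite (Series_ext _ (fun _ => 0 * 0)).
- rewrite Series_scal_l; ring.
- intros n; rewrite Rmult_0_l, <- (Rmult_0_r (c (Z.of_nat (S n)))); f_equal.
  rewrite <- (iter_fdiff_pow k j (INR (S n))).
  apply iter_fdiff_ext; [exact E|apply lt_0_INR; lia].
Qed.

(** Continuity from the right kills the constant term; dividing by [h] then shifts the coefficients
    and keeps the hypotheses. *)
Lemma pseries_zero_right (d : nat -> R) (r : R) : 0 < r -> Rbar_le r (CV_radius d) ->
  (forall h, 0 < h < r -> PSeries d h = 0) -> forall j, d j = 0.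
Proof.
intros Hr Hd H j; revert d Hd H; induction j as [|j IH]; intros d Hd H.
all: assert (H0 : d O = 0).
1, 3: 
  assert (C : continuity_pt (PSeries d) 0)
    by (apply PSeries_continuity; rewrite Rabs_R0;
        apply Rbar_lt_le_trans with r; easy);
  apply continuity_pt_filterlim in C; rewrite PSeries_0 in C;
  assert (C2 : filterlim (PSeries d) (at_right 0) (locally (d O)))
    by (eapply filterlim_filter_le_1; [|exact C]; apply filter_le_within);
  assert (C3 : filterlim (PSeries d) (at_right 0) (locally 0))
    by (apply filterlim_ext_loc with (fun _ => 0); [|apply filterlim_const];
        exists (mkposreal r Hr); intros y Hy Hy0; symmetry; apply H;
        split; [easy|]; unfold ball in Hy; simpl in Hy;
        unfold AbsRing_ball, abs, minus, plus, opp in Hy; simpl in Hy;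
        rewrite Rabs_right in Hy; lra);
  exact (filterlim_locally_unique _ _ _ C2 C3).
- exact H0.
- change (d (S j)) with (PS_decr_1 d j); apply IH; [now rewrite CV_radius_decr_1|].
  intros h Hh.
  assert (E := H h Hh); rewrite PSeries_decr_1, H0, Rplus_0_l in E.
  + destruct (Rmult_integral _ _ E); [lra|easy].
  + apply CV_radius_inside; rewrite Rabs_right by lra.
    apply Rbar_lt_le_trans with r; [simpl; lra|easy].
Qed.

Lemma ex_pseries_radius (d : nat -> R) (h : R) : ex_series (fun j => d j * h ^ j) ->
  Rbar_le (Rabs h) (CV_radius d).
Proof.
intros H; destruct (Rbar_le_lt_dec (Rabs h) (CV_radius d)) as [L|L]; [exact L|].
exfalso; apply (CV_disk_outside d h L), ex_series_lim_0, H.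
Qed.

(** Let [t] be the supremum of the points where [D] is nonzero. Vanishing to the right of [t] kills
    the whole power series at [t], so [D] also vanishes slightly to the left, against the choice of
    [t]. *)
Lemma real_analytic_identity (D : R -> R) (lo b : R) :
  (forall s, lo < s -> exists d r, 0 < r /\
     forall h, Rabs h < r -> is_series (fun j => d j * h ^ j) (D (s + h))) ->
  (forall s, b <= s -> D s = 0) -> forall s, lo < s -> D s = 0.
Proof.
intros Han Hz s1 Hs1; apply NNPP; intros Hne.
destruct (completeness (fun x => lo < x /\ D x <> 0)) as [t [Hub Hlub]].
- exists b; intros x [_ Hx]; destruct (Rle_or_lt x b) as [L|L]; [easy|].
  exfalso; apply Hx, Hz; lra.
- now exists s1.
- assert (Ht : s1 <= t) by now apply Hub.
  assert (Hright : forall x, t < x -> D x = 0).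
  { intros x Hx; apply NNPP; intros N.
    assert (x <= t) by (apply Hub; split; [lra|easy]); lra. }
  destruct (Han t) as [d [r [Hr Hd]]]; [lra|].
  assert (Hd0 : forall j, d j = 0).
  { apply (pseries_zero_right d (r / 2)); [lra| |].
    - replace (r / 2) with (Rabs (r / 2)) by (apply Rabs_right; lra).
      apply ex_pseries_radius; exists (D (t + r / 2)); apply Hd.
      rewrite Rabs_right; lra.
    - intros h Hh; rewrite <- (Hright (t + h)) by lra.
      unfold PSeries; apply is_series_unique, Hd; rewrite Rabs_right; lra. }
  assert (Hall : forall h, Rabs h < r -> D (t + h) = 0).
  { intros h Hh; rewrite <- (is_series_unique _ _ (Hd h Hh)).
    rewrite (Series_ext _ (fun _ => 0 * 0)), Series_scal_l; [ring|].
    intros j; rewrite Hd0; ring. }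
  assert (t <= t - r / 2); [|lra].
  apply Hlub; intros x [Hx Hx0]; destruct (Rle_or_lt x (t - r / 2)) as [L|L]; [easy|].
  exfalso; apply Hx0; destruct (Rle_or_lt x t) as [L'|L']; [|now apply Hright].
  replace x with (t + (x - t)) by ring; apply Hall, Rabs_def1; lra.
Qed.

(** * Expansion for smooth rapidly decreasing functions *)

Lemma is_derive_n_tower (G : nat -> R -> R) :
  (forall k x, is_derive (G k) x (G (S k) x)) ->
  forall k x, is_derive_n (G O) k x (G k x).
Proof.
intros HG k; induction k as [|k IH]; intros x; [easy|].
simpl; apply is_derive_ext with (G k); [|apply HG].
intros y; symmetry; apply is_derive_n_unique, IH.
Qed.

Lemma tower_taylor (G : nat -> R -> R) (N : nat) (C y : R) :
  (forall k x, is_derive (G k) x (G (S k) x)) ->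
  (forall x, 0 <= x -> Rabs (G (S N) x) <= C) -> 0 < y ->
  Rabs (G O y - sum_n (fun k => G k 0 / INR (fact k) * y ^ k) N) <= C * y ^ S N.
Proof.
intros HG HC Hy.
destruct (Taylor_Lagrange (G O) N 0 y Hy) as [z [Hz E]].
{ intros t _ k _; destruct k as [|k]; [easy|]; eexists.
  apply (is_derive_n_tower G HG (S k)). }
assert (ED : forall k x, Derive_n (G O) k x = G k x)
  by (intros; now apply is_derive_n_unique, is_derive_n_tower).
rewrite E, Rminus_0_r, ED, sum_n_Reals.
rewrite (sum_eq _ (fun k => G k 0 / INR (fact k) * y ^ k)).
2: { intros k _; rewrite ED; unfold Rdiv; ring. }
rewrite Rplus_comm; unfold Rminus; rewrite Rplus_assoc, Rplus_opp_r, Rplus_0_r.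
rewrite Rabs_mult, Rmult_comm.
apply Rmult_le_compat; [apply Rabs_pos..|apply HC; lra|].
assert (Hp : 0 <= y ^ S N) by (apply pow_le; lra).
assert (Hf : 1 <= INR (fact (S N))) by (apply (le_INR 1); generalize (lt_O_fact (S N)); lia).
rewrite Rabs_right.
- apply Rmult_le_reg_r with (INR (fact (S N))); [lra|].
  unfold Rdiv; rewrite Rmult_assoc, Rinv_l by lra; nra.
- apply Rle_ge, Rmult_le_pos; [easy|left; apply Rinv_0_lt_compat; lra].
Qed.

Lemma twisted_sum_expansion (p N : nat) (a : Z -> R) (G : nat -> R -> R) :
  zero_mean p a -> bounded_seq a ->
  (forall k x, is_derive (G k) x (G (S k) x)) ->
  (forall k, exists C, forall x, 0 <= x -> Rabs (G k x) <= C * / (1 + x) ^ 2) ->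
  exists K, forall t, 0 < t <= 1 ->
    Rabs (twisted_sum a (fun x => G O (t * x))
      - sum_n (fun k => ibp_head p (S (S (S N))) a (fun x => x ^ k)
                        * (G k 0 / INR (fact k)) * t ^ k) N) <= K * t ^ S N.
Proof.
intros Hz Hb HG HC.
(* With this [m], [2 - m < - k] for all [k <= N], so that the heads below can be identified with
   values of [L]. *)
set (m := S (S (S N))).
destruct (HC O) as [C0 HC0].
destruct (HC (S N)) as [C1 HC1].
destruct (HC m) as [C2 HC2].
destruct (ibp_head_bound p m a) as [M1 [HM1 HH]].
destruct (ibp_tail_bound p m a Hb) as [M2 [HM2 HT]].
assert (Hinv : forall x, 0 <= x -> 0 < / (1 + x) ^ 2 <= 1).
{ intros x Hx; split; [apply Rinv_0_lt_compat, pow_lt; lra|].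
  rewrite <- Rinv_1; apply Rinv_le_contravar; [lra|nra]. }
assert (Hpos : forall C k, (forall x, 0 <= x -> Rabs (G k x) <= C * / (1 + x) ^ 2) -> 0 <= C).
{ intros C k H; assert (H' := H 0 (Rle_refl 0)).
  replace ((1 + 0) ^ 2) with 1 in H' by ring; rewrite Rinv_1 in H'.
  generalize (Rabs_pos (G k 0)); lra. }
assert (HC0p := Hpos _ _ HC0); assert (HC1p := Hpos _ _ HC1); assert (HC2p := Hpos _ _ HC2).
exists (M1 * (C1 * INR (S m) ^ S N) + M2 * C2); intros t Ht.
set (f := fun x => G O (t * x)).
assert (Hsum : summable f).
{ apply summable_inv_sqr with (C0 * / t ^ 2); intros x Hx; unfold f.
  eapply Rle_trans; [apply HC0; nra|].
  rewrite Rmult_assoc; apply Rmult_le_compat_l; [easy|].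
  rewrite <- Rinv_mult; apply Rinv_le_contravar.
  - apply Rmult_lt_0_compat; apply pow_lt; lra.
  - rewrite <- Rpow_mult_distr; apply pow_incr; nra. }
rewrite (twisted_sum_ibp p m a f Hz Hb Hsum).
(* The Taylor polynomial of [f], read as a polynomial in [x] with [t] fixed. The head samples
   [x <= S m] only, so there [f - P] is [O(t ^ S N)] uniformly. *)
set (P := fun x => sum_n (fun k => G k 0 / INR (fact k) * t ^ k * x ^ k) N).
assert (EP : ibp_head p m a P = sum_n (fun k => ibp_head p m a (fun x => x ^ k)
                        * (G k 0 / INR (fact k)) * t ^ k) N).
{ unfold P; rewrite ibp_head_sum; apply sum_n_ext; intros k.
  rewrite ibp_head_scal; real_ring. }
rewrite <- EP.
rewrite (ibp_head_ext _ _ _ f (fun x => P x + (f x - P x))) by (intros; ring).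
rewrite ibp_head_plus.
match goal with |- Rabs ?X <= _ =>
  replace X with (ibp_head p m a (fun x => f x - P x) + ibp_tail p m a f) by ring end.
eapply Rle_trans; [apply Rabs_triang|].
rewrite Rmult_plus_distr_r; apply Rplus_le_compat.
- rewrite Rmult_assoc; apply HH; intros x Hx.
  replace (P x) with (sum_n (fun k => G k 0 / INR (fact k) * (t * x) ^ k) N).
  2: { apply sum_n_ext; intros k; rewrite Rpow_mult_distr; real_ring. }
  eapply Rle_trans; [apply (tower_taylor G N C1)|]; [easy| |nra|].
  + intros y Hy; eapply Rle_trans; [now apply HC1|].
    generalize (Hinv y Hy); nra.
  + rewrite Rpow_mult_distr, Rmult_assoc, (Rmult_comm (t ^ S N)).
    apply Rmult_le_compat_l; [easy|].
    apply Rmult_le_compat_r; [apply pow_le; lra|apply pow_incr; lra].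
- set (u := fun k => C2 * t ^ m * / (1 + t * INR (S k)) ^ 2).
  assert (Htm : 0 < t ^ m) by (apply pow_lt; lra).
  assert (Htm1 : 0 < t ^ S (S N)) by (apply pow_lt; lra).
  (* The sum of [/ (1 + t * n) ^ 2] is a Riemann sum of mesh [t], bounded by [1 / t]. Telescoping
     [/ (1 + t * k)] makes this precise and leaves [t ^ (m - 1)]. *)
  destruct (telescoping_series u (fun k => C2 * t ^ S (S N) * / (1 + t * INR k)))
    as [Hu1 Hu2].
  + intros k; unfold u; assert (Hk := pos_INR k).
    assert (Hk1 : 0 < 1 + t * INR k) by nra.
    assert (Hk2 : 0 < 1 + t * INR (S k)) by (rewrite S_INR; nra).
    split; [apply Rmult_le_pos; [nra|left; apply Rinv_0_lt_compat, pow_lt; lra]|].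
    replace (C2 * t ^ S (S N) * / (1 + t * INR k) - C2 * t ^ S (S N) * / (1 + t * INR (S k)))
      with (C2 * t ^ m * (/ (1 + t * INR k) * / (1 + t * INR (S k)))).
    2: { rewrite S_INR in Hk2 |- *; change (t ^ m) with (t * t ^ S (S N)).
         generalize (t ^ S (S N)); intros; field; split; apply Rgt_not_eq; lra. }
    apply Rmult_le_compat_l; [nra|].
    rewrite <- Rinv_mult; apply Rinv_le_contravar; [nra|].
    rewrite S_INR in Hk2 |- *; nra.
  + intros k; apply Rmult_le_pos; [nra|].
    left; apply Rinv_0_lt_compat; generalize (pos_INR k); nra.
  + simpl INR in Hu2; rewrite Rmult_0_r, Rplus_0_r, Rinv_1, Rmult_1_r in Hu2.
    assert (Hbd : forall k, Rabs (iter_fdiff m f (INR (S k))) <= u k).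
    { intros k; assert (Hk : 0 < INR (S k)) by (apply lt_0_INR; lia).
      (* The factor [t ^ 0] exhibits [f] as the bottom of the tower [t ^ i * G i (t * x)] given by
         the chain rule. *)
      unfold f; replace (fun x => G O (t * x)) with (fun x => t ^ 0 * G O (t * x)).
      2: { apply functional_extensionality; intros x; ring. }
      apply (iter_fdiff_bound m (fun i x => t ^ i * G i (t * x))).
      - intros i x _; replace (t ^ S i * G (S i) (t * x))
          with (t ^ i * (t * G (S i) (t * x))) by (simpl; ring).
        apply is_derive_scal.
        apply (is_derive_comp (G i) (fun x => t * x)); [apply HG|].
        auto_derive; [easy|ring].
      - easy.
      - intros y Hy; rewrite Rabs_mult, Rabs_right by lra.
        unfold u; rewrite (Rmult_comm C2), Rmult_assoc.
        apply Rmult_le_compat_l; [lra|].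
        eapply Rle_trans; [apply HC2; nra|].
        apply Rmult_le_compat_l; [easy|].
        assert (0 < 1 + t * INR (S k)) by nra.
        apply Rinv_le_contravar; [now apply pow_lt|].
        apply pow_incr; nra. }
    assert (Hs : summable (iter_fdiff m f)).
    { apply (ex_series_le (V := R_CompleteNormedModule) _ u); [|easy].
      intros k; unfold norm; simpl; unfold abs; simpl; rewrite Rabs_Rabsolu; apply Hbd. }
    eapply Rle_trans; [now apply HT|].
    rewrite Rmult_assoc; apply Rmult_le_compat_l; [easy|].
    eapply Rle_trans; [apply Series_le; [|exact Hu1]|].
    { intros k; split; [apply Rabs_pos|apply Hbd]. }
    eapply Rle_trans; [exact Hu2|].
    apply Rmult_le_compat_l; [easy|].
    assert (0 < t ^ S N) by (apply pow_lt; lra).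
    change (t * t ^ S N <= t ^ S N); nra.
Qed.

(** * Derivatives of the Gaussian *)

Definition is_Cderive (f : R -> C) (x : R) (l : C) : Prop :=
  is_derive (fun y => Re (f y)) x (Re l) /\ is_derive (fun y => Im (f y)) x (Im l).

Lemma is_Cderive_mult (f g : R -> C) (x : R) (lf lg : C) :
  is_Cderive f x lf -> is_Cderive g x lg ->
  is_Cderive (fun y => f y * g y)%C x (lf * g x + f x * lg)%C.
Proof.
intros [Hf1 Hf2] [Hg1 Hg2]; split.
- evar_last.
  { apply (is_derive_minus (fun y => Re (f y) * Re (g y)) (fun y => Im (f y) * Im (g y))).
    - exact (is_derive_mult _ _ x _ _ Hf1 Hg1 Rmult_comm).
    - exact (is_derive_mult _ _ x _ _ Hf2 Hg2 Rmult_comm). }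
  unfold minus, plus, opp, mult; simpl; unfold Re, Im; ring.
- evar_last.
  { apply (is_derive_plus (fun y => Re (f y) * Im (g y)) (fun y => Im (f y) * Re (g y))).
    - exact (is_derive_mult _ _ x _ _ Hf1 Hg2 Rmult_comm).
    - exact (is_derive_mult _ _ x _ _ Hf2 Hg1 Rmult_comm). }
  unfold minus, plus, opp, mult; simpl; unfold Re, Im; ring.
Qed.

Lemma is_Cderive_minus (f g : R -> C) (x : R) (lf lg : C) :
  is_Cderive f x lf -> is_Cderive g x lg ->
  is_Cderive (fun y => f y - g y)%C x (lf - lg)%C.
Proof.
intros [Hf1 Hf2] [Hg1 Hg2]; split.
- exact (is_derive_minus _ _ x _ _ Hf1 Hg1).
- exact (is_derive_minus _ _ x _ _ Hf2 Hg2).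
Qed.

Lemma is_Cderive_const (c : C) (x : R) : is_Cderive (fun _ => c) x 0%C.
Proof.
split; apply (is_derive_const (K := R_AbsRing) (V := R_NormedModule)).
Qed.

(* The derivatives of the Gaussian, by the Hermite three-term recurrence. *)
Fixpoint gaussian_deriv (v w : C) (k : nat) (x : R) : C :=
  (match k with
   | O => Cexp (- (w * RtoC (x ^ 2)) - v * RtoC x)
   | S p =>
       (- (2 * w * RtoC x) - v) * gaussian_deriv v w p x -
       match p with
       | O => 0
       | S m => 2 * w * RtoC (INR p) * gaussian_deriv v w m x
       end
   end)%C.

Lemma gaussian_deriv_SS (v w : C) (k : nat) (x : R) :
  gaussian_deriv v w (S (S k)) x
  = ((- (2 * w * RtoC x) - v) * gaussian_deriv v w (S k) x
     - 2 * w * RtoC (INR (S k)) * gaussian_deriv v w k x)%C.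
Proof. reflexivity. Qed.

Lemma is_Cderive_gaussian (v w : C) (x : R) :
  is_Cderive (gaussian_deriv v w 0) x (gaussian_deriv v w 1 x).
Proof.
destruct v as [v1 v2], w as [w1 w2].
assert (ERe : forall y, Re (- ((w1, w2) * RtoC (y ^ 2)) - (v1, v2) * RtoC y)%C
  = - (w1 * y ^ 2) - v1 * y) by (intros; simpl; ring).
assert (EIm : forall y, Im (- ((w1, w2) * RtoC (y ^ 2)) - (v1, v2) * RtoC y)%C
  = - (w2 * y ^ 2) - v2 * y) by (intros; simpl; ring).
split; cbn [gaussian_deriv]; unfold Cexp.
- apply is_derive_ext with
    (fun y => exp (- (w1 * y ^ 2) - v1 * y) * cos (- (w2 * y ^ 2) - v2 * y)).
  { intros y; now rewrite ERe, EIm. }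
  auto_derive; [easy|]; rewrite ERe, EIm.
  change (- (w1 * (x * (x * 1))) + - (v1 * x)) with (- (w1 * x ^ 2) - v1 * x).
  change (- (w2 * (x * (x * 1))) + - (v2 * x)) with (- (w2 * x ^ 2) - v2 * x).
  generalize (exp (- (w1 * x ^ 2) - v1 * x)), (cos (- (w2 * x ^ 2) - v2 * x)),
    (sin (- (w2 * x ^ 2) - v2 * x)); intros; simpl; ring.
- apply is_derive_ext with
    (fun y => exp (- (w1 * y ^ 2) - v1 * y) * sin (- (w2 * y ^ 2) - v2 * y)).
  { intros y; now rewrite ERe, EIm. }
  auto_derive; [easy|]; rewrite ERe, EIm.
  change (- (w1 * (x * (x * 1))) + - (v1 * x)) with (- (w1 * x ^ 2) - v1 * x).
  change (- (w2 * (x * (x * 1))) + - (v2 * x)) with (- (w2 * x ^ 2) - v2 * x).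
  generalize (exp (- (w1 * x ^ 2) - v1 * x)), (cos (- (w2 * x ^ 2) - v2 * x)),
    (sin (- (w2 * x ^ 2) - v2 * x)); intros; simpl; ring.
Qed.

Lemma is_Cderive_gaussian_deriv (v w : C) (k : nat) (x : R) :
  is_Cderive (gaussian_deriv v w k) x (gaussian_deriv v w (S k) x).
Proof.
assert (Hu : is_Cderive (fun y => - (2 * w * RtoC y) - v)%C x (- (2 * w))%C).
{ destruct v as [v1 v2], w as [w1 w2]; split; simpl; auto_derive; try easy; ring. }
enough (H : is_Cderive (gaussian_deriv v w k) x (gaussian_deriv v w (S k) x) /\
  is_Cderive (gaussian_deriv v w (S k)) x (gaussian_deriv v w (S (S k)) x)) by easy.
induction k as [|k [IH1 IH2]]; split; [apply is_Cderive_gaussian| |exact IH2|].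
- assert (H := is_Cderive_minus _ _ _ _ _
    (is_Cderive_mult _ _ _ _ _ Hu (is_Cderive_gaussian v w x)) (is_Cderive_const 0 x)).
  rewrite gaussian_deriv_SS; evar_last; [exact H|]; simpl INR; cbv beta; ring.
- assert (H := is_Cderive_minus _ _ _ _ _ (is_Cderive_mult _ _ _ _ _ Hu IH2)
   (is_Cderive_mult _ _ _ _ _ (is_Cderive_const (2 * w * RtoC (INR (S k)))%C x) IH1)).
  rewrite (gaussian_deriv_SS v w (S k)); evar_last; [exact H|].
  rewrite (S_INR (S k)), RtoC_plus; cbv beta; ring.
Qed.

Lemma Cmod_Cexp (z : C) : Cmod (Cexp z) = exp (Re z).
Proof.
unfold Cmod, Cexp; simpl.
replace (exp (Re z) * cos (Im z) * (exp (Re z) * cos (Im z) * 1)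
  + exp (Re z) * sin (Im z) * (exp (Re z) * sin (Im z) * 1))
  with (Rsqr (exp (Re z)) * (Rsqr (sin (Im z)) + Rsqr (cos (Im z))))
  by (unfold Rsqr; ring).
rewrite sin2_cos2, Rmult_1_r, sqrt_Rsqr; [easy|left; apply exp_pos].
Qed.

Lemma Cexp_add (z z' : C) : Cexp (z + z')%C = (Cexp z * Cexp z')%C.
Proof.
destruct z as [x y], z' as [x' y']; unfold Cexp, Cmult; simpl.
rewrite exp_plus, cos_plus, sin_plus; f_equal; ring.
Qed.

Lemma Cexp_0 : Cexp 0%C = 1%C.
Proof. unfold Cexp; simpl; rewrite exp_0, cos_0, sin_0; apply injective_projections; simpl; ring. Qed.

(** Each derivative is the Gaussian times a polynomial of degree at most [k], and the modulus of the
    Gaussian sees only the real parts of [v] and [w]. *)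
Lemma gaussian_deriv_growth (v w : C) (k : nat) :
  exists C, 0 <= C /\ forall x, 0 <= x ->
    Cmod (gaussian_deriv v w k x)
    <= C * (1 + x) ^ k * exp (- (Re w * x ^ 2) - Re v * x).
Proof.
assert (E0 : forall x, Cmod (gaussian_deriv v w 0 x) = exp (- (Re w * x ^ 2) - Re v * x)).
{ intros x; cbn [gaussian_deriv]; rewrite Cmod_Cexp; f_equal.
  destruct v as [v1 v2], w as [w1 w2]; simpl; ring. }
set (A := Cmod (2 * w)%C + Cmod v).
assert (HA : 0 <= A) by (generalize (Cmod_ge_0 (2 * w)%C) (Cmod_ge_0 v); unfold A; lra).
assert (Hu : forall x, 0 <= x -> Cmod (- (2 * w * RtoC x) - v)%C <= A * (1 + x)).
{ intros x Hx; unfold Cminus; eapply Rle_trans; [apply Cmod_triangle|].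
  rewrite !Cmod_opp, Cmod_mult, Cmod_R, (Rabs_right x) by lra; unfold A.
  generalize (Cmod_ge_0 (2 * w)%C) (Cmod_ge_0 v); nra. }
set (P := fun k => exists C, 0 <= C /\ forall x, 0 <= x ->
    Cmod (gaussian_deriv v w k x)
    <= C * (1 + x) ^ k * exp (- (Re w * x ^ 2) - Re v * x)).
enough (H : P k /\ P (S k)) by apply H.
induction k as [|k [IH1 IH2]]; split; [|  |exact IH2|].
- exists 1; split; [lra|]; intros x _; rewrite E0; simpl; lra.
- exists A; split; [easy|]; intros x Hx; cbn [gaussian_deriv].
  replace (_ - 0)%C with ((- (2 * w * RtoC x) - v) * gaussian_deriv v w 0 x)%C
    by (cbn [gaussian_deriv]; ring).
  rewrite Cmod_mult, E0, pow_1.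
  apply Rmult_le_compat_r; [left; apply exp_pos|now apply Hu].
- destruct IH1 as [C1 [HC1 H1]], IH2 as [C2 [HC2 H2]].
  set (B := Cmod (2 * w * RtoC (INR (S k)))%C).
  assert (HB : 0 <= B) by apply Cmod_ge_0.
  exists (A * C2 + B * C1); split; [nra|]; intros x Hx.
  rewrite gaussian_deriv_SS; unfold Cminus at 1.
  eapply Rle_trans; [apply Cmod_triangle|]; rewrite Cmod_opp, !(Cmod_mult _ (gaussian_deriv _ _ _ _)).
  fold B; specialize (H1 x Hx); specialize (H2 x Hx); specialize (Hu x Hx).
  revert H1 H2; generalize (exp_pos (- (Re w * x ^ 2) - Re v * x)).
  generalize (exp (- (Re w * x ^ 2) - Re v * x)); intros E HE H1 H2.
  assert (Hp : 1 <= (1 + x) ^ k) by (apply pow_R1_Rle; lra).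
  assert (L1 : Cmod (- (2 * w * RtoC x) - v)%C * Cmod (gaussian_deriv v w (S k) x)
    <= (A * (1 + x)) * (C2 * (1 + x) ^ S k * E)).
  { apply Rmult_le_compat; try apply Cmod_ge_0; easy. }
  assert (L2 : B * Cmod (gaussian_deriv v w k x) <= B * (C1 * (1 + x) ^ k * E)).
  { now apply Rmult_le_compat_l. }
  assert (L3 : C1 * (1 + x) ^ k * E <= C1 * (1 + x) ^ S (S k) * E).
  { apply Rmult_le_compat_r; [lra|]; apply Rmult_le_compat_l; [easy|].
    apply Rle_pow; [lra|lia]. }
  assert (L4 : B * (C1 * (1 + x) ^ k * E) <= B * (C1 * (1 + x) ^ S (S k) * E))
    by now apply Rmult_le_compat_l.
  replace ((A * C2 + B * C1) * (1 + x) ^ S (S k) * E)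
    with (A * (1 + x) * (C2 * (1 + x) ^ S k * E) + B * (C1 * (1 + x) ^ S (S k) * E))
    by (simpl; ring).
  lra.
Qed.

Lemma gaussian_deriv_decay (v w : C) (k : nat) : 0 < Re w ->
  exists C, forall x, 0 <= x -> Cmod (gaussian_deriv v w k x) <= C * / (1 + x) ^ 2.
Proof.
intros Hw; destruct (gaussian_deriv_growth v w k) as [C [HC H]].
set (al := Re w) in *; set (be := Re v) in *.
(* The maximum of [1 + x - al * x ^ 2 - be * x], by completing the square. The [1 + x] comes from
   bounding [(1 + x) ^ (k + 2)] by [(k + 2)! * exp (1 + x)]. *)
set (c := 1 + (1 - be) ^ 2 * / (4 * al)).
exists (C * (INR (fact (k + 2)) * exp c)); intros x Hx.
eapply Rle_trans; [now apply H|].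
assert (Hp : 0 < (1 + x) ^ 2) by (apply pow_lt; lra).
apply Rmult_le_reg_r with ((1 + x) ^ 2); [easy|].
rewrite (Rmult_assoc _ (/ _)), Rinv_l, Rmult_1_r by lra.
replace (C * (1 + x) ^ k * exp (- (al * x ^ 2) - be * x) * (1 + x) ^ 2)
  with (C * ((1 + x) ^ (k + 2) * exp (- (al * x ^ 2) - be * x)))
  by (rewrite pow_add; ring).
apply Rmult_le_compat_l; [easy|].
assert (Hf := INR_fact_lt_0 (k + 2)).
assert (Hexp : (1 + x) ^ (k + 2) <= INR (fact (k + 2)) * exp (1 + x)).
{ apply Rmult_le_reg_r with (/ INR (fact (k + 2))); [now apply Rinv_0_lt_compat|].
  rewrite (Rmult_comm (INR _)), Rmult_assoc, Rinv_r, Rmult_1_r by lra.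
  apply pow_div_fact_le_exp; lra. }
apply Rle_trans with (INR (fact (k + 2)) * exp (1 + x) * exp (- (al * x ^ 2) - be * x)).
- apply Rmult_le_compat_r; [left; apply exp_pos|easy].
- rewrite Rmult_assoc, <- exp_plus; apply Rmult_le_compat_l; [lra|].
  assert (L : 1 + x + (- (al * x ^ 2) - be * x) <= c).
  { assert (Hi : 0 < / (4 * al)) by (apply Rinv_0_lt_compat; lra).
    assert (E : c - (1 + x + (- (al * x ^ 2) - be * x))
      = (2 * al * x - (1 - be)) ^ 2 * / (4 * al)) by (unfold c; field; lra).
    assert (0 <= (2 * al * x - (1 - be)) ^ 2) by apply pow2_ge_0.
    assert (0 <= (2 * al * x - (1 - be)) ^ 2 * / (4 * al)) by (apply Rmult_le_pos; lra).
    lra. }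
  destruct (Rle_lt_or_eq_dec _ _ L) as [L'|L'].
  + left; now apply exp_increasing.
  + rewrite L'; lra.
Qed.

(** * Expansion of the twisted theta series *)

Lemma Cmod_le_Rabs (z : C) : Cmod z <= Rabs (Re z) + Rabs (Im z).
Proof.
destruct z as [x y]; simpl.
replace (x, y) with (RtoC x + RtoC y * Ci)%C
  by (apply injective_projections; simpl; ring).
eapply Rle_trans; [apply Cmod_triangle|].
rewrite Cmod_mult, !Cmod_R, Cmod_Ci; lra.
Qed.

Lemma Rabs_Im_le_Cmod (z : C) : Rabs (Im z) <= Cmod z.
Proof. eapply Rle_trans; [apply Rmax_r|apply (Rmax_Cmod z)]. Qed.

Lemma Csum_n_components (a : nat -> C) (n : nat) :
  sum_n (G := C_AbelianMonoid) a n
  = (sum_n (fun k => Re (a k)) n, sum_n (fun k => Im (a k)) n).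
Proof.
induction n as [|n IH].
- rewrite !sum_O; now destruct (a O).
- rewrite sum_Sn, IH, !sum_n_S; now destruct (a (S n)).
Qed.

Lemma twisted_theta_components (chi : Z -> C) (v w : C) (t : R) : real_character chi ->
  twisted_theta chi v w t
  = (twisted_sum (fun n => Re (chi n)) (fun x => Re (gaussian_deriv v w 0 (t * x))),
     twisted_sum (fun n => Re (chi n)) (fun x => Im (gaussian_deriv v w 0 (t * x)))).
Proof.
intros Hr; unfold twisted_theta, CSeries, twisted_sum.
assert (E : forall k, (chi (Z.of_nat (S k)) *
  Cexp (- (w * RtoC (INR (S k) ^ 2) * RtoC (t ^ 2)) - v * RtoC (INR (S k)) * RtoC t)
  = RtoC (Re (chi (Z.of_nat (S k)))) * gaussian_deriv v w 0 (t * INR (S k)))%C).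
{ intros k; f_equal.
  - apply injective_projections; [easy|apply Hr].
  - cbn [gaussian_deriv]; f_equal.
    rewrite Rpow_mult_distr, !RtoC_mult; ring. }
f_equal; apply Series_ext; intros k; cbv zeta; rewrite E.
- simpl (Re (_ * _)%C); unfold Re, Im; simpl; ring.
- unfold Re, Im; simpl; ring.
Qed.

(** The number of summations by parts grows with [N], while [b] must not: the last hypothesis asks
    that [b k] match the head for every admissible [N]. *)
Lemma twisted_theta_expansion (p : nat) (chi : Z -> C) (v w : C) (b : nat -> C) :
  real_character chi -> zero_mean p (fun n => Re (chi n)) ->
  bounded_seq (fun n => Re (chi n)) -> 0 < Re w ->
  (forall N k, (k <= N)%nat -> b k =
    (RtoC (ibp_head p (S (S (S N))) (fun n => Re (chi n)) (fun x => x ^ k)%R)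
     * (gaussian_deriv v w k 0 / RtoC (INR (fact k))))%C) ->
  asymptotic_expansion (twisted_theta chi v w) b.
Proof.
intros Hr Hz Hb Hw Hcoef N.
set (a := fun n => Re (chi n)) in *.
destruct (twisted_sum_expansion p N a (fun k x => Re (gaussian_deriv v w k x)) Hz Hb)
  as [K1 HK1].
{ intros k x; apply is_Cderive_gaussian_deriv. }
{ intros k; destruct (gaussian_deriv_decay v w k Hw) as [C HC]; exists C; intros x Hx.
  eapply Rle_trans; [apply re_le_Cmod|now apply HC]. }
destruct (twisted_sum_expansion p N a (fun k x => Im (gaussian_deriv v w k x)) Hz Hb)
  as [K2 HK2].
{ intros k x; apply is_Cderive_gaussian_deriv. }
{ intros k; destruct (gaussian_deriv_decay v w k Hw) as [C HC]; exists C; intros x Hx.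
  eapply Rle_trans; [apply Rabs_Im_le_Cmod|now apply HC]. }
exists (K1 + K2); exists (mkposreal 1 Rlt_0_1); intros t Ht Ht0.
assert (Ht1 : 0 < t <= 1).
{ unfold ball in Ht; simpl in Ht; unfold AbsRing_ball, abs, minus, plus, opp in Ht.
  simpl in Ht; rewrite Rabs_right in Ht; lra. }
rewrite Csum_n_components, twisted_theta_components by easy; fold a.
eapply Rle_trans; [apply Cmod_le_Rabs|]; rewrite Rmult_plus_distr_r.
assert (Hfact : forall k, (/ RtoC (INR (fact k)))%C = RtoC (/ INR (fact k)))
  by (intros k; now rewrite RtoC_inv by apply INR_fact_neq_0).
apply Rplus_le_compat; [eapply Rle_trans; [right|apply (HK1 t Ht1)]
                       |eapply Rle_trans; [right|apply (HK2 t Ht1)]].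
- simpl Re; f_equal; unfold Rminus; do 2 f_equal.
  apply sum_n_ext_loc; intros k Hk; rewrite (Hcoef N k Hk); unfold Cdiv; rewrite Hfact.
  fold a; generalize (ibp_head p (S (S (S N))) a (fun x => x ^ k)); intros l.
  destruct (gaussian_deriv v w k 0) as [x y]; unfold Re, Rdiv; simpl; real_ring.
- simpl Im; f_equal; unfold Rminus; do 2 f_equal.
  apply sum_n_ext_loc; intros k Hk; rewrite (Hcoef N k Hk); unfold Cdiv; rewrite Hfact.
  fold a; generalize (ibp_head p (S (S (S N))) a (fun x => x ^ k)); intros l.
  destruct (gaussian_deriv v w k 0) as [x y]; unfold Im, Rdiv; simpl; real_ring.
Qed.

(** * Dirichlet characters and values of L-functions *)

Lemma is_Cseries_components (a : nat -> C) (l : C) :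
  is_series (K := C_AbsRing) (V := C_NormedModule) a l ->
  is_series (fun k => Re (a k)) (Re l) /\ is_series (fun k => Im (a k)) (Im l).
Proof.
intros H; split.
- apply filterlim_ext with (fun n => fst (sum_n (G := C_AbelianMonoid) a n)).
  { intros n; now rewrite Csum_n_components. }
  apply filterlim_comp with (1 := H).
  intros P [e He]; exists e; intros y Hy; apply He, Hy.
- apply filterlim_ext with (fun n => snd (sum_n (G := C_AbelianMonoid) a n)).
  { intros n; now rewrite Csum_n_components. }
  apply filterlim_comp with (1 := H).
  intros P [e He]; exists e; intros y Hy; apply He, Hy.
Qed.

Lemma analytic_on_C_real (L : C -> C) (s : R) : analytic_on_C L ->
  exists (d e : nat -> R) r, 0 < r /\ forall h, Rabs h < r ->
    is_series (fun j => d j * h ^ j) (Re (L (RtoC (s + h)))) /\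
    is_series (fun j => e j * h ^ j) (Im (L (RtoC (s + h)))).
Proof.
intros H; destruct (H (RtoC s)) as [al [r Hr]].
exists (fun j => Re (al j)), (fun j => Im (al j)), r; split; [apply cond_pos|].
intros h Hh.
assert (E : (RtoC (s + h) - RtoC s)%C = RtoC h) by (rewrite RtoC_plus; ring).
assert (Hs := Hr (RtoC (s + h))); rewrite E, Cmod_R in Hs; specialize (Hs Hh).
assert (Ep : forall j, pow_n (K := C_Ring) (RtoC h) j = RtoC (h ^ j)).
{ induction j as [|j IH]; [easy|]; simpl; rewrite IH, RtoC_mult; easy. }
destruct (is_Cseries_components _ _ Hs) as [H1 H2]; split.
- eapply is_series_ext; [|exact H1]; intros j; cbv beta.
  change (Re (pow_n (K := C_Ring) (RtoC h) j * al j)%C = Re (al j) * h ^ j).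
  rewrite Ep; unfold Re, Im; simpl; real_ring.
- eapply is_series_ext; [|exact H2]; intros j; cbv beta.
  change (Im (pow_n (K := C_Ring) (RtoC h) j * al j)%C = Im (al j) * h ^ j).
  rewrite Ep; unfold Re, Im; simpl; real_ring.
Qed.

Lemma RCpow_real (x s : R) : RCpow x (- RtoC s)%C = RtoC (Rpower x (- s)).
Proof.
unfold RCpow, Cexp, Rpower; apply injective_projections; simpl.
- replace ((- s * 0 + - 0 * ln x)) with 0 by ring.
  rewrite cos_0, Rmult_1_r; f_equal; ring.
- replace ((- s * 0 + - 0 * ln x)) with 0 by ring.
  rewrite sin_0; ring.
Qed.

(** Both [Re L - regularised_dirichlet] and [Im L] are real analytic for [s > 2 - m] and vanish for
    [s >= 2]; the point [- k] lies in this half-line because [m >= k + 3]. The slack [i] lets a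
    single [m] serve several [k]. *)
Lemma L_function_neg (p k i : nat) (chi : Z -> C) (L : C -> C) :
  L_function chi L -> real_character chi ->
  zero_mean p (fun n => Re (chi n)) -> bounded_seq (fun n => Re (chi n)) ->
  L (RtoC (- INR k))
  = RtoC (ibp_head p (S (S (S (i + k)))) (fun n => Re (chi n)) (fun x => x ^ k)).
Proof.
intros [Han Hser] Hr Hz Hb; set (a := fun n => Re (chi n)) in *.
set (m := S (S (S (i + k)))).
assert (Hlo : 2 - INR m < - INR k).
{ unfold m; rewrite !S_INR, plus_INR; generalize (pos_INR i); lra. }
assert (Hs2 : forall s, 2 <= s ->
  Re (L (RtoC s)) = regularised_dirichlet p m a s /\ Im (L (RtoC s)) = 0).
{ intros s Hs; destruct (is_Cseries_components _ _ (Hser (RtoC s) ltac:(simpl; lra))) as [H1 H2].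
  assert (E : forall j, (chi (Z.of_nat (S j)) * RCpow (INR (S j)) (- RtoC s))%C
    = RtoC (a (Z.of_nat (S j)) * Rpower (INR (S j)) (- s))).
  { intros j; rewrite RCpow_real, RtoC_mult; f_equal.
    apply injective_projections; [easy|apply Hr]. }
  split.
  - rewrite regularised_dirichlet_eq by easy; symmetry; apply is_series_unique.
    eapply is_series_ext; [|exact H1]; intros j; cbv beta; now rewrite E.
  - rewrite <- (is_series_unique _ _ H2), (Series_ext _ (fun _ => 0 * 0)).
    + rewrite Series_scal_l; ring.
    + intros j; rewrite E; simpl; ring. }
assert (HRe : Re (L (RtoC (- INR k))) - regularised_dirichlet p m a (- INR k) = 0).
{ apply (real_analytic_identity
    (fun s => Re (L (RtoC s)) - regularised_dirichlet p m a s) (2 - INR m) 2); [| |easy].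
  - intros s Hs; destruct (analytic_on_C_real L s Han) as [d [e [r [Hr0 Hd]]]].
    exists (fun j => d j - (ibp_head p m a (log_power 0 s j)
                       + ibp_tail p m a (log_power 0 s j))), (Rmin r (s + INR m - 2)).
    split; [apply Rmin_pos; lra|]; intros h Hh.
    assert (Hh1 := Rlt_le_trans _ _ _ Hh (Rmin_l _ _)).
    assert (Hh2 := Rlt_le_trans _ _ _ Hh (Rmin_r _ _)).
    evar_last; [eapply is_series_ext;
      [|exact (is_series_lin _ _ 1 (-1) _ _ (proj1 (Hd h Hh1))
         (regularised_dirichlet_series p m a s h Hb Hh2))]|real_ring].
    intros j; real_ring.
  - intros s Hs; rewrite (proj1 (Hs2 s Hs)); ring. }
assert (HIm : Im (L (RtoC (- INR k))) = 0).
{ apply (real_analytic_identity (fun s => Im (L (RtoC s))) (2 - INR m) 2); [| |easy].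
  - intros s _; destruct (analytic_on_C_real L s Han) as [d [e [r [Hr0 Hd]]]].
    exists e, r; split; [easy|]; intros h Hh; now apply Hd.
  - intros s Hs; apply (Hs2 s Hs). }
assert (F := regularised_dirichlet_neg p k (S (S i)) a Hb).
change (S (S (S i) + k)) with m in F; rewrite <- F.
apply injective_projections; [|exact HIm].
unfold Re in HRe at 1; simpl fst; lra.
Qed.

Lemma sum_n_fold (f : nat -> R) (p : nat) :
  sum_n f p = fold_right Rplus 0 (map f (seq 0 (S p))) :> R.
Proof.
revert f; induction p as [|p IH]; intros f; [rewrite sum_O; simpl; ring|].
rewrite sum_n_head, IH.
change (map f (seq 0 (S (S p)))) with (f O :: map f (seq 1 (S p))).
now rewrite <- seq_shift, map_map.
Qed.

Lemma fold_Rplus_permutation (l l' : list R) :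
  Permutation l l' -> fold_right Rplus 0 l = fold_right Rplus 0 l'.
Proof.
intros H; induction H as [|x l l' _ IH|x y l|l l' l'' _ IH1 _ IH2]; simpl.
- easy.
- now rewrite IH.
- ring.
- now rewrite IH1.
Qed.

(** Multiplication by a unit permutes the residues: it is injective by Gauss's lemma, hence
    bijective by counting. *)
Lemma sum_n_residues_mul (a : Z -> R) (p : nat) (m : Z) :
  (forall n, a (n mod Z.of_nat (S p))%Z = a n) -> Z.gcd m (Z.of_nat (S p)) = 1%Z ->
  sum_n (fun i => a (m * Z.of_nat i)%Z) p = sum_n (fun i => a (Z.of_nat i)) p :> R.
Proof.
intros Hper Hg; set (q := Z.of_nat (S p)) in *.
assert (Hq : (0 < q)%Z) by lia.
set (sig := fun i => Z.to_nat ((m * Z.of_nat i) mod q)).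
assert (Hsig : forall i, Z.of_nat (sig i) = ((m * Z.of_nat i) mod q)%Z).
{ intros i; unfold sig; apply Z2Nat.id, Z.mod_pos_bound, Hq. }
rewrite !sum_n_fold.
rewrite (map_ext _ (fun i => a (Z.of_nat (sig i)))).
2: { intros i; now rewrite Hsig, Hper. }
rewrite <- (map_map sig (fun i => a (Z.of_nat i))).
apply fold_Rplus_permutation, Permutation_map, NoDup_Permutation_bis.
- apply Injective_map_NoDup_in; [|apply seq_NoDup].
  intros i j Hi Hj E; apply in_seq in Hi, Hj.
  assert (E' : ((m * Z.of_nat i) mod q = (m * Z.of_nat j) mod q)%Z)
    by (rewrite <- !Hsig; now f_equal).
  assert (D : (q | m * (Z.of_nat i - Z.of_nat j))%Z).
  { apply Z.mod_divide; [lia|].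
    rewrite Z.mul_sub_distr_l, Zminus_mod, E', Z.sub_diag; apply Zmod_0_l. }
  apply Z.gauss in D; [|now rewrite Z.gcd_comm].
  destruct D as [c Hc]; assert (c = 0)%Z by nia; lia.
- now rewrite length_map.
- intros x Hx; apply in_map_iff in Hx; destruct Hx as [i [<- _]].
  apply in_seq; assert (B := Z.mod_pos_bound (m * Z.of_nat i) q Hq).
  rewrite <- Hsig in B; lia.
Qed.

Lemma periodic_mod (f : Z -> C) (q n : Z) : (0 < q)%Z ->
  (forall n, f (n + q)%Z = f n) -> f (n mod q)%Z = f n.
Proof.
intros Hq Hf.
assert (H : forall k x, f (x + Z.of_nat k * q)%Z = f x).
{ induction k as [|k IH]; intros x; [f_equal; lia|].
  rewrite <- (IH x), <- (Hf (x + Z.of_nat k * q)%Z); f_equal; lia. }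
assert (E := Z.div_mod n q).
destruct (Z.le_gt_cases 0 (n / q)) as [L|L].
- rewrite <- (H (Z.to_nat (n / q)) (n mod q)%Z); f_equal.
  rewrite Z2Nat.id by easy; lia.
- rewrite <- (H (Z.to_nat (- (n / q))) n); f_equal.
  rewrite Z2Nat.id by lia; lia.
Qed.

(** Choose a unit [m] with [chi m <> 1]. Replacing [n] by [m * n] permutes the residues and
    multiplies the sum over a period by [chi m], so this sum is 0. *)
Lemma dirichlet_zero_mean (q : Z) (chi : Z -> C) :
  dirichlet_character q chi -> real_character chi -> ~ principal_character q chi ->
  exists p, q = Z.of_nat (S p) /\ zero_mean p (fun n => Re (chi n)) /\
    bounded_seq (fun n => Re (chi n)).
Proof.
intros [Hq [Hper [Hmul Hne]]] Hr Hnp; set (a := fun n => Re (chi n)).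
assert (Echi : forall n, chi n = RtoC (a n)).
{ intros n; apply injective_projections; [easy|apply Hr]. }
exists (Z.to_nat (q - 1)).
assert (Eq : q = Z.of_nat (S (Z.to_nat (q - 1)))) by lia.
revert Eq; generalize (Z.to_nat (q - 1)); intros p Eq.
assert (Hmod : forall n, a (n mod q)%Z = a n)
  by (intros n; unfold a; now rewrite periodic_mod).
split; [exact Eq|]; split.
- assert (Hm : exists m, Z.gcd m q = 1%Z /\ a m <> 1).
  { apply NNPP; intros N; apply Hnp; intros n Hn; rewrite Echi; f_equal.
    apply NNPP; intros N'; apply N; now exists n. }
  destruct Hm as [m [Hg Hm]].
  assert (Hsum : sum_n (fun i => a (Z.of_nat i)) p = 0 :> R).
  { assert (E : sum_n (fun i => a (m * Z.of_nat i)%Z) p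
      = sum_n (fun i => a (Z.of_nat i)) p * a m :> R).
    { rewrite <- sum_n_scal_r; apply sum_n_ext; intros i; unfold a at 1.
      rewrite Hmul, !Echi, <- RtoC_mult; simpl; real_ring. }
    rewrite sum_n_residues_mul in E; [|now rewrite <- Eq|now rewrite <- Eq].
    assert (F : sum_n (fun i => a (Z.of_nat i)) p * (a m - 1) = 0) by lra.
    destruct (Rmult_integral _ _ F) as [G|G]; [exact G|exfalso; lra]. }
  (* From one period to all windows: sliding by one replaces an end value by its periodic copy. *)
  assert (Hstep : forall n, sum_n (fun i => a (n - Z.of_nat i)%Z) p
    = sum_n (fun i => a (n - 1 - Z.of_nat i)%Z) p :> R).
  { intros n; destruct p as [|p].
    - rewrite !sum_O; unfold a; rewrite <- (Hper (n - 1 - Z.of_nat 0)%Z); do 2 f_equal; lia.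
    - rewrite sum_n_head, sum_n_S, Rplus_comm; f_equal.
      + apply sum_n_ext; intros i; f_equal; lia.
      + unfold a; rewrite <- (Hper (n - 1 - Z.of_nat (S p))%Z); do 2 f_equal; lia. }
  assert (Hp : sum_n (fun i => a (Z.of_nat p - Z.of_nat i)%Z) p = 0 :> R).
  { rewrite <- Hsum, <- sum_n_rev; apply sum_n_ext_loc; intros i Hi; f_equal; lia. }
  assert (Hup : forall k n, sum_n (fun i => a (n + Z.of_nat k - Z.of_nat i)%Z) p
    = sum_n (fun i => a (n - Z.of_nat i)%Z) p :> R).
  { induction k as [|k IH]; intros n.
    - apply sum_n_ext; intros i; f_equal; lia.
    - rewrite <- (IH n), (Hstep (n + Z.of_nat (S k))%Z); apply sum_n_ext; intros i; f_equal; lia. }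
  intros n; destruct (Z.le_gt_cases n (Z.of_nat p)) as [Hl|Hl].
  + rewrite <- (Hup (Z.to_nat (Z.of_nat p - n)) n), <- Hp.
    apply sum_n_ext; intros i; f_equal; lia.
  + rewrite <- Hp, <- (Hup (Z.to_nat (n - Z.of_nat p)) (Z.of_nat p)).
    apply sum_n_ext; intros i; f_equal; lia.
- exists (sum_n (fun i => Rabs (a (Z.of_nat i))) p); intros n.
  change (Rabs (a n) <= sum_n (fun i => Rabs (a (Z.of_nat i))) p).
  rewrite <- Hmod; assert (B := Z.mod_pos_bound n q Hq).
  rewrite <- (Z2Nat.id (n mod q)) by lia.
  assert (Hi : (Z.to_nat (n mod q) <= p)%nat) by lia.
  revert Hi; generalize (Z.to_nat (n mod q)); clear.
  induction p as [|p IH]; intros i Hi.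
  + rewrite sum_O; replace i with O by lia; apply Rle_refl.
  + rewrite sum_n_S; destruct (Nat.eq_dec i (S p)) as [->|N].
    * assert (H0 := IH O (Nat.le_0_l p)).
      revert H0; change (Z.of_nat 0) with 0%Z; generalize (Rabs_pos (a 0%Z)); intros; lra.
    * assert (H0 := IH i ltac:(lia)).
      generalize (Rabs_pos (a (Z.of_nat (S p)))); lra.
Qed.

(** * Hermite polynomials *)

Lemma hermite_SS (n : nat) (x : C) :
  (hermite (S (S n)) x
   = 2 * x * hermite (S n) x - 2 * RtoC (INR (S n)) * hermite n x)%C.
Proof. reflexivity. Qed.

(** Completing the square, [w * x ^ 2 + v * x = (sg * x + y) ^ 2 - y ^ 2], and the [k]-th derivative
    of [exp (- u ^ 2)] is [(- 1) ^ k * hermite k u * exp (- u ^ 2)]. The proof compares three-term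
    recurrences instead. *)
Lemma gaussian_deriv_hermite (v w sg y : C) (k : nat) :
  (sg * sg = w)%C -> (2 * (sg * y) = v)%C ->
  gaussian_deriv v w k 0 = ((- sg) ^ k * hermite k y)%C.
Proof.
intros Hs Hy.
assert (H0 : gaussian_deriv v w 0 0 = 1%C).
{ cbn [gaussian_deriv]; rewrite <- Cexp_0; f_equal; replace (0 ^ 2) with 0 by ring; ring. }
assert (H1 : gaussian_deriv v w 1 0 = (- v)%C).
{ replace (gaussian_deriv v w 1 0)
    with ((- (2 * w * 0) - v) * gaussian_deriv v w 0 0 - 0)%C by reflexivity.
  rewrite H0; ring. }
enough (H : gaussian_deriv v w k 0 = ((- sg) ^ k * hermite k y)%C /\
  gaussian_deriv v w (S k) 0 = ((- sg) ^ S k * hermite (S k) y)%C) by apply H.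
induction k as [|k [IH1 IH2]]; split; [| |exact IH2|].
- rewrite H0; simpl; ring.
- rewrite H1, <- Hy; simpl; ring.
- rewrite gaussian_deriv_SS, hermite_SS, IH1, IH2, <- Hy, <- Hs, !Cpow_S; ring.
Qed.

Lemma gaussian_deriv_weber (v w : C) (k : nat) : w <> 0%C ->
  gaussian_deriv v w k 0
  = (Cexp (v ^ 2 / (8 * w)) * (Csqrt (2 * w) ^ k * (- (1)) ^ k *
     parabolic_cylinder_D k (v / Csqrt (2 * w))))%C.
Proof.
intros Hw; assert (Hs := Csqrt_sqr (2 * w)%C); set (s := Csqrt (2 * w)%C) in *.
assert (H20 : RtoC 2 <> 0%C) by (intros F; apply (f_equal fst) in F; simpl in F; lra).
assert (Hs0 : s <> 0%C).
{ intros E; rewrite E in Hs; apply Hw.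
  replace w with (2 * w / 2)%C by (field; exact H20).
  rewrite <- Hs; unfold Cdiv; ring. }
set (c := RtoC (sqrt 2)).
assert (Hc : (c * c = 2)%C) by (unfold c; rewrite <- RtoC_mult, sqrt_sqrt by lra; easy).
assert (Hc0 : c <> 0%C).
{ unfold c; intros E; apply (f_equal fst) in E; simpl in E.
  generalize (sqrt_lt_R0 2); lra. }
assert (Ew : w = (s * s / (c * c))%C) by (rewrite Hs, Hc; field; exact H20).
(* [s / c] is a square root of [w], and [v / s / c] is the Hermite argument inside
   [parabolic_cylinder_D k (v / s)]. Its exponential cancels [Cexp (v ^ 2 / (8 * w))] because
   [s * s = 2 * w], and the powers of [/ c] are its [2 ^ (- k / 2)]. *)
rewrite (gaussian_deriv_hermite v w (s / c) (v / s / c)).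
- unfold parabolic_cylinder_D; fold c.
  assert (Ee : (Cexp (v ^ 2 / (8 * w)) * Cexp (- ((v / s) ^ 2 / 4)) = 1)%C).
  { rewrite <- Cexp_add, <- Cexp_0; f_equal.
    replace (8 * w)%C with (4 * (s * s))%C by (rewrite Hs; ring).
    simpl; field; now repeat split. }
  assert (Er : RtoC (Rpower 2 (- INR k / 2)) = ((/ c) ^ k)%C).
  { unfold c; rewrite <- RtoC_inv by (generalize (sqrt_lt_R0 2); lra).
    rewrite <- RtoC_pow; f_equal.
    replace (- INR k / 2) with (- (/ 2 * INR k)) by (unfold Rdiv; ring).
    rewrite Rpower_Ropp, <- Rpower_mult, Rpower_sqrt, Rpower_pow by
      (try apply sqrt_lt_R0; lra).
    now rewrite pow_inv. }
  rewrite Er.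
  replace (- (s / c))%C with (s * - (1) * / c)%C by (unfold Cdiv; ring).
  rewrite !Cpow_mult_l.
  transitivity ((Cexp (v ^ 2 / (8 * w)) * Cexp (- ((v / s) ^ 2 / 4))) *
    (s ^ k * (- (1)) ^ k * (/ c) ^ k * hermite k (v / s / c)))%C; [rewrite Ee|]; ring.
- rewrite Ew; field; exact Hc0.
- transitivity (2 * v / (c * c))%C; [field; now split|rewrite Hc; field; exact H20].
Qed.

(** * Parity of the character and conclusion *)

Lemma real_character_reflect (q : Z) (chi : Z -> C) (n : Z) :
  dirichlet_character q chi -> real_character chi ->
  Re (chi (- n)%Z) = Re (chi (-1)%Z) * Re (chi n).
Proof.
intros [_ [_ [Hmul _]]] Hr.
replace (- n)%Z with (-1 * n)%Z by lia; rewrite Hmul.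
assert (E1 := Hr (-1)%Z); assert (E2 := Hr n); unfold Re, Im in *.
simpl; rewrite E1, E2; ring.
Qed.

(** A nonzero value at 0 forces modulus 1, because [gcd 0 q = q]; but then each window is a single
    value, which is 0. *)
Lemma zero_mean_chi_0 (p : nat) (chi : Z -> C) :
  dirichlet_character (Z.of_nat (S p)) chi -> zero_mean p (fun n => Re (chi n)) ->
  Re (chi 0%Z) = 0.
Proof.
intros [_ [_ [_ Hne]]] Hz; apply NNPP; intros N.
assert (Hg : Z.gcd 0 (Z.of_nat (S p)) = 1%Z).
{ apply Hne; intros E; apply N; now rewrite E. }
rewrite Z.gcd_0_l in Hg; assert (Hp : p = O) by lia; subst p.
apply N; generalize (Hz 0%Z); now rewrite sum_O.
Qed.

Open Scope C_scope.

Theorem theorem1p4 (q : Z) (chi : Z -> C) (L : C -> C) (v w : C)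
  (hchi : dirichlet_character q chi)
  (hreal : real_character chi)
  (hprim : primitive_character q chi)
  (hnonpr : ~ principal_character q chi)
  (hL : L_function chi L)
  (hw : (0 < Re w)%R) :
  (even_character chi ->
     asymptotic_expansion (twisted_theta chi v w)
       (odd_powers (fun n : nat =>
          Cexp (v ^ 2 / (8 * w)) *
          (Csqrt (2 * w) ^ (2 * n + 1) * (-(1)) ^ (2 * n + 1)
             / RtoC (INR (fact (2 * n + 1)))
           * L (- (2 * RtoC (INR n)) - 1)
           * parabolic_cylinder_D (2 * n + 1) (v / Csqrt (2 * w)))))) /\
  (odd_character chi ->
     asymptotic_expansion (twisted_theta chi v w)
       (even_powers (fun n : nat =>
          Cexp (v ^ 2 / (8 * w)) *
          ((2 * w) ^ n * (-(1)) ^ (2 * n)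
             / RtoC (INR (fact (2 * n)))
           * L (- (2 * RtoC (INR n)))
           * parabolic_cylinder_D (2 * n) (v / Csqrt (2 * w)))))).
Proof.
destruct (dirichlet_zero_mean q chi hchi hreal hnonpr) as [p [-> [Hz Hb]]].
assert (Hw0 : w <> 0) by (intros E; rewrite E in hw; simpl in hw; lra).
assert (H0 := zero_mean_chi_0 p chi hchi Hz).
assert (HL : forall N k, (k <= N)%nat -> L (RtoC (- INR k))
  = RtoC (ibp_head p (S (S (S N))) (fun n => Re (chi n)) (fun x => x ^ k)%R)).
{ intros N k Hk; rewrite (L_function_neg p k (N - k) chi L) by easy.
  now rewrite Nat.sub_add. }
split; intros Hpar; apply (twisted_theta_expansion p); try easy; intros N k Hk;
  rewrite <- (HL N k Hk).
- unfold odd_powers; destruct (Nat.odd k) eqn:Hodd.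
  + apply Nat.odd_spec in Hodd; destruct Hodd as [n ->].
    replace (Nat.div2 (2 * n + 1)) with n
      by (rewrite Nat.add_1_r, Nat.div2_succ_double; easy).
    rewrite gaussian_deriv_weber by easy.
    replace (- (2 * RtoC (INR n)) - 1) with (RtoC (- INR (2 * n + 1))).
    2: { rewrite plus_INR, mult_INR, RtoC_opp, RtoC_plus, RtoC_mult; simpl INR.
         change (RtoC (1 + 1)) with (RtoC 2); ring. }
    unfold Cdiv; ring.
  (* A power missing from the claimed expansion: its coefficient must be 0, and it is so by the
     trivial zero of [L] at [- k]. *)
  + rewrite (HL N k Hk).
    replace (S (S (S N))) with (S (S (S N) - k + k)) by lia.
    rewrite ibp_head_pow_even; try easy.
    * unfold Cdiv; ring.
    * intros n; rewrite (real_character_reflect _ chi n hchi hreal), Hpar; simpl; ring.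
    * now rewrite <- Nat.negb_odd, Hodd.
- unfold even_powers; destruct (Nat.even k) eqn:Heven.
  + apply Nat.even_spec in Heven; destruct Heven as [n ->].
    rewrite Nat.div2_double, gaussian_deriv_weber by easy.
    replace (- (2 * RtoC (INR n))) with (RtoC (- INR (2 * n))).
    2: { rewrite mult_INR, RtoC_opp, RtoC_mult; simpl INR.
         change (RtoC (1 + 1)) with (RtoC 2); ring. }
    (* Even powers of the square root collapse to the integer powers [(2 * w) ^ n] of the
       statement. *)
    rewrite (Cpow_mult_r (Csqrt (2 * w))).
    replace (Csqrt (2 * w) ^ 2) with (2 * w) by (rewrite <- (Csqrt_sqr (2 * w)) at 1; ring).
    unfold Cdiv; ring.
  + rewrite (HL N k Hk).
    replace (S (S (S N))) with (S (S (S N) - k + k)) by lia.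
    rewrite ibp_head_pow_odd; try easy.
    * unfold Cdiv; ring.
    * intros n; rewrite (real_character_reflect _ chi n hchi hreal), Hpar; simpl; ring.
    * now rewrite <- Nat.negb_even, Heven.
Qed.
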